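(* Let $(H,\mathcal R,\bar{\mathcal R})$ be a quasitriangular weak Hopf algebra and let $(\Theta,\bar\Theta)$ be a twist for $H$. Then the twisted weak Hopf algebra $H_\Theta$ is quasitriangular, with quasitriangular structure $$(\bar\Theta_{21}\,\mathcal R\,\Theta,\ \ \bar\Theta\,\bar{\mathcal R}\,\Theta_{21}).$$
   Context: $k$ is an algebraically closed field; Sweedler notation $\Delta(h)=h_{(1)}\otimes h_{(2)}$ is used. A weak bialgebra is a $k$-vector space $H$ with an algebra structure $(m,1)$ and a coalgebra structure $(\Delta,\varepsilon)$ such that for all $h,g,f\in H$: $\Delta(hg)=\Delta(h)\Delta(g)$; $\varepsilon(hgf)=\varepsilon(hg_{(1)})\varepsilon(g_{(2)}f)=\varepsilon(hg_{(2)})\varepsilon(g_{(1)}f)$; $(\Delta\otimes\mathrm{id})\Delta(1)=(\Delta(1)\otimes1)(1\otimes\Delta(1))=(1\otimes\Delta(1))(\Delta(1)\otimes1)$. A weak Hopf algebra is a weak bialgebra with a linear map $S:H\to H$ (antipode) such that $m(\mathrm{id}\otimes S)\Delta(h)=(\varepsilon\otimes\mathrm{id})(\Delta(1)(h\otimes1))$, $m(S\otimes\mathrm{id})\Delta(h)=(\mathrm{id}\otimes\varepsilon)((1\otimes h)\Delta(1))$, and $S(h_{(1)})h_{(2)}S(h_{(3)})=S(h)$ for all $h\in H$. A quasitriangular weak Hopf algebra is a triple $(H,\mathcal R,\bar{\mathcal R})$ with $H$ a weak Hopf algebra, $\mathcal R\in\Delta^{op}(1)(H\otimes H)\Delta(1)$,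 $\bar{\mathcal R}\in\Delta(1)(H\otimes H)\Delta^{op}(1)$, $\mathcal R\bar{\mathcal R}=\Delta^{op}(1)$, $\bar{\mathcal R}\mathcal R=\Delta(1)$, $\Delta^{op}(h)\mathcal R=\mathcal R\Delta(h)$ for all $h\in H$, $(\mathrm{id}\otimes\Delta)\mathcal R=\mathcal R_{13}\mathcal R_{12}$ and $(\Delta\otimes\mathrm{id})\mathcal R=\mathcal R_{13}\mathcal R_{23}$. Here $\Delta^{op}$ is the opposite comultiplication. A twist for $H$ is a pair $(\Theta,\bar\Theta)$ with $\Theta\in\Delta(1)(H\otimes H)$, $\bar\Theta\in(H\otimes H)\Delta(1)$, $\Theta\bar\Theta=\Delta(1)$, satisfying $(\varepsilon\otimes\mathrm{id})\Theta=(\mathrm{id}\otimes\varepsilon)\Theta=(\varepsilon\otimes\mathrm{id})\bar\Theta=(\mathrm{id}\otimes\varepsilon)\bar\Theta=1$, $(\Delta\otimes\mathrm{id})(\Theta)(\Theta\otimes1)=(\mathrm{id}\otimes\Delta)(\Theta)(1\otimes\Theta)$, $(\bar\Theta\otimes1)(\Delta\otimes\mathrm{id})(\bar\Theta)=(1\otimes\bar\Theta)(\mathrm{id}\otimes\Delta)(\bar\Theta)$, $(\Delta\otimes\mathrm{id})(\bar\Theta)(\mathrm{id}\otimes\Delta)(\Theta)=(\Theta\otimes1)(1\otimes\bar\Theta)$, $(\mathrm{id}\otimes\Delta)(\bar\Theta)(\Delta\otimes\mathrm{id})(\Theta)=(1\otimes\Theta)(\bar\Theta\otimes1)$. The twisted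 weak Hopf algebra $H_\Theta$ has the algebra structure and counit of $H$, comultiplication $\Delta_\Theta(h)=\bar\Theta\Delta(h)\Theta$ and antipode $S_\Theta(h)=v^{-1}S(h)v$ with $v=m(S\otimes\mathrm{id})\Theta$ (which is invertible). $\Theta_{21}$ denotes $\Theta$ with its two tensor factors exchanged. *)

(* Defs.v *)
From HB Require Import structures.
From mathcomp Require Import all_boot all_order all_algebra.
From mathcomp Require Import boolp.

Set Implicit Arguments.
Unset Strict Implicit.
Unset Printing Implicit Defensive.

Import GRing.Theory.
Local Open Scope ring_scope.
Local Open Scope quotient_scope.

(* Unital associative algebras over k.  MathComp's algType requires 1 != 0;    *)
(* here the zero algebra is allowed.  The instance that follows makes such an  *)
(* algebra a pzRingType, so that 1 and x * y are the ring operations.          *)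
HB.mixin Record Lmodule_isPzAlgebra (k : comPzRingType) A
    of GRing.Lmodule k A := {
  pzalg_one : A;
  pzalg_mul : A -> A -> A;
  pzalg_mulA : associative pzalg_mul;
  pzalg_mul1 : left_id pzalg_one pzalg_mul;
  pzalg_mulr1 : right_id pzalg_one pzalg_mul;
  pzalg_mulDl : left_distributive pzalg_mul +%R;
  pzalg_mulDr : right_distributive pzalg_mul +%R;
  pzalg_scaleAl : forall (a : k) x y,
    a *: pzalg_mul x y = pzalg_mul (a *: x) y;
  pzalg_scaleAr : forall (a : k) x y,
    a *: pzalg_mul x y = pzalg_mul x (a *: y)
}.

#[short(type="pzAlgType")]
HB.structure Definition PzAlgebra (k : comPzRingType) :=
  {A of GRing.Lmodule k A & Lmodule_isPzAlgebra k A}.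

#[non_forgetful_inheritance]
HB.instance Definition _ (k : comPzRingType) (A : pzAlgType k) :=
  GRing.Zmodule_isPzRing.Build (PzAlgebra.sort A)
    (@pzalg_mulA k A) (@pzalg_mul1 k A) (@pzalg_mulr1 k A)
    (@pzalg_mulDl k A) (@pzalg_mulDr k A).

Lemma pzscalerAl (k : comPzRingType) (A : pzAlgType k) (a : k) (x y : A) :
  a *: (x * y) = (a *: x) * y.
Proof. exact: pzalg_scaleAl. Qed.

Lemma pzscalerAr (k : comPzRingType) (A : pzAlgType k) (a : k) (x y : A) :
  a *: (x * y) = x * (a *: y).
Proof. exact: pzalg_scaleAr. Qed.

(* The tensor product of two modules, of arbitrary dimension: finite formal    *)
(* sums [:: (u1, v1); ...; (un, vn)] of pairs, modulo the congruence generated *)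
(* by the bilinearity relations.                                               *)
Section TensorProduct.
Context (k : comPzRingType) (U V : lmodType k).

Inductive tens_rel : seq (U * V) -> seq (U * V) -> Prop :=
| TRrefl s : tens_rel s s
| TRsym s t : tens_rel s t -> tens_rel t s
| TRtrans s t r : tens_rel s t -> tens_rel t r -> tens_rel s r
| TRcat s s' t t' :
    tens_rel s s' -> tens_rel t t' -> tens_rel (s ++ t) (s' ++ t')
| TRcatC s t : tens_rel (s ++ t) (t ++ s)
| TR0 v : tens_rel [:: (0, v)] [::]
| TRDl u u' v : tens_rel [:: (u + u', v)] [:: (u, v); (u', v)]
| TRDr u v v' : tens_rel [:: (u, v + v')] [:: (u, v); (u, v')]
| TRZ a u v : tens_rel [:: (a *: u, v)] [:: (u, a *: v)].

Definition tens_relb s t := `[< tens_rel s t >].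

Lemma tens_relb_refl : reflexive tens_relb.
Proof. by move=> s; apply/asboolP; exact: TRrefl. Qed.

Lemma tens_relb_sym : symmetric tens_relb.
Proof. by move=> s t; apply/asboolP/asboolP; exact: TRsym. Qed.

Lemma tens_relb_trans : transitive tens_relb.
Proof.
by move=> t s r /asboolP st /asboolP tr; apply/asboolP; exact: TRtrans st tr.
Qed.

Canonical tens_equiv :=
  EquivRel tens_relb tens_relb_refl tens_relb_sym tens_relb_trans.

Definition tensor := {eq_quot tens_equiv}.

HB.instance Definition _ := Choice.on tensor.
HB.instance Definition _ := Quotient.on tensor.
HB.instance Definition _ := EqQuotient.on tensor.

Lemma tens_piP s t : (\pi_tensor s = \pi_tensor t) <-> tens_rel s t.
Proof.
split; first by move/eqmodP/asboolP.
by move=> st; apply/eqmodP/asboolP.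
Qed.

Definition tens_add (x y : tensor) : tensor := \pi_tensor (repr x ++ repr y).
Definition tens_scale (a : k) (x : tensor) : tensor :=
  \pi_tensor [seq (a *: p.1, p.2) | p <- repr x].
Definition tens_opp (x : tensor) : tensor := tens_scale (- 1) x.

Lemma tens_repr s : tens_rel (repr (\pi_tensor s)) s.
Proof. by apply/tens_piP; rewrite reprK. Qed.

Lemma tens_addE s t :
  tens_add (\pi_tensor s) (\pi_tensor t) = \pi_tensor (s ++ t).
Proof. by apply/tens_piP; apply: TRcat; exact: tens_repr. Qed.

Lemma tens_rel_scale a s t : tens_rel s t ->
  tens_rel [seq (a *: p.1, p.2) | p <- s] [seq (a *: p.1, p.2) | p <- t].
Proof.
elim=> {s t}.
- by move=> s; exact: TRrefl.
- by move=> s t _; exact: TRsym.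
- by move=> s t r _ st _; exact: TRtrans st.
- by move=> s s' t t' _ ss _ tt; rewrite !map_cat; exact: TRcat.
- by move=> s t; rewrite !map_cat; exact: TRcatC.
- by move=> v /=; rewrite scaler0; exact: TR0.
- by move=> u u' v /=; rewrite scalerDr; exact: TRDl.
- by move=> u v v' /=; exact: TRDr.
- by move=> b u v /=; rewrite scalerA mulrC -scalerA; exact: TRZ.
Qed.

Lemma tens_scaleE a s :
  tens_scale a (\pi_tensor s) = \pi_tensor [seq (a *: p.1, p.2) | p <- s].
Proof. by apply/tens_piP; apply: tens_rel_scale; exact: tens_repr. Qed.

Lemma tens_addA : associative tens_add.
Proof.
move=> x y z.
elim/quotW: x => x; elim/quotW: y => y; elim/quotW: z => z.
by rewrite (tens_addE y z) (tens_addE x y) !tens_addE catA.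
Qed.

Lemma tens_addC : commutative tens_add.
Proof. by move=> x y; apply/tens_piP; exact: TRcatC. Qed.

Lemma tens_add0 : left_id (\pi_tensor [::]) tens_add.
Proof. by elim/quotW=> x; rewrite tens_addE. Qed.

Lemma tens_addN : left_inverse (\pi_tensor [::]) tens_opp tens_add.
Proof.
elim/quotW; elim=> [|[u v] s IHs].
  by rewrite /tens_opp tens_scaleE tens_addE.
have -> : \pi_tensor ((u, v) :: s)
          = tens_add (\pi_tensor [:: (u, v)]) (\pi_tensor s).
  by rewrite tens_addE.
have -> : tens_opp (tens_add (\pi_tensor [:: (u, v)]) (\pi_tensor s))
          = tens_add (\pi_tensor [:: (- u, v)]) (tens_opp (\pi_tensor s)).
  rewrite /tens_opp (tens_addE [:: (u, v)] s) !tens_scaleE.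
  by rewrite (tens_addE [:: (- u, v)]) /= scaleN1r.
rewrite -tens_addA (tens_addA (tens_opp _)) (tens_addC (tens_opp _)).
rewrite -(tens_addA (\pi_tensor [:: (u, v)])) IHs.
rewrite (tens_addC _ (\pi_tensor [::])) tens_add0.
rewrite tens_addE; apply/tens_piP.
by apply: TRtrans (TR0 v); rewrite -(addNr u); apply: TRsym; exact: TRDl.
Qed.

HB.instance Definition _ :=
  GRing.isZmodule.Build tensor tens_addA tens_addC tens_add0 tens_addN.

Lemma tens_scaleA a b (x : tensor) :
  tens_scale a (tens_scale b x) = tens_scale (a * b) x.
Proof.
elim/quotW: x => x; rewrite (tens_scaleE b) !tens_scaleE -map_comp; congr (\pi_tensor _).
by apply: eq_map => p /=; rewrite scalerA.
Qed.

Lemma tens_scale1 : left_id 1 tens_scale.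
Proof.
elim/quotW=> x; rewrite tens_scaleE; congr (\pi_tensor _).
by rewrite -[RHS]map_id; apply: eq_map => -[u v] /=; rewrite scale1r.
Qed.

Lemma tens_scaleDr : right_distributive tens_scale +%R.
Proof.
move=> a; elim/quotW=> x; elim/quotW=> y.
rewrite [X in tens_scale _ X]tens_addE !tens_scaleE map_cat.
by rewrite -tens_addE.
Qed.

Lemma tens_scaleDl (x : tensor) : {morph tens_scale^~ x : a b / a + b}.
Proof.
move=> a b; elim/quotW: x => x; rewrite !tens_scaleE.
rewrite [RHS]tens_addE; apply/tens_piP.
elim: x => [|[u v] s IHs] /=; first exact: TRrefl.
rewrite scalerDl.
apply: TRtrans (TRcat (TRDl (a *: u) (b *: u) v) IHs) _.
set s1 := map _ _; set s2 := map _ _.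
rewrite -cat1s -[X in tens_rel _ X]cat1s -catA.
apply: TRcat; first exact: TRrefl.
rewrite -[_ :: s2]cat1s !catA; apply: TRcat; last exact: TRrefl.
exact: TRcatC.
Qed.

HB.instance Definition _ := GRing.Zmodule_isLmodule.Build k tensor
  tens_scaleA tens_scale1 tens_scaleDr tens_scaleDl.

Definition tens (u : U) (v : V) : tensor := \pi_tensor [:: (u, v)].

Lemma tensDl u u' v : tens (u + u') v = tens u v + tens u' v.
Proof. by rewrite [RHS]tens_addE; apply/tens_piP; exact: TRDl. Qed.

Lemma tensDr u v v' : tens u (v + v') = tens u v + tens u v'.
Proof. by rewrite [RHS]tens_addE; apply/tens_piP; exact: TRDr. Qed.

Lemma tensZl a u v : tens (a *: u) v = a *: tens u v.
Proof. by rewrite [RHS]tens_scaleE. Qed.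

Lemma tensZr a u v : tens u (a *: v) = a *: tens u v.
Proof. by rewrite -tensZl; apply/tens_piP; apply: TRsym; exact: TRZ. Qed.

Lemma tens_sum (x : tensor) : x = \sum_(p <- repr x) tens p.1 p.2.
Proof.
rewrite -[LHS]reprK; elim: (repr x) => [|[u v] s IHs]; first by rewrite big_nil.
by rewrite big_cons -IHs /= [RHS]tens_addE.
Qed.

Lemma tens_ind (P : tensor -> Prop) :
  P 0 -> (forall u v x, P x -> P (tens u v + x)) -> forall x, P x.
Proof.
move=> P0 PD x; rewrite [x]tens_sum.
by elim: (repr x) => [|p s IHs]; rewrite ?big_nil // big_cons; apply: PD.
Qed.

End TensorProduct.

Notation "U ⊗ V" := (tensor U V) (at level 40, left associativity) : type_scope.
Notation "u ⊗ v" := (tens u v) (at level 40, left associativity) : ring_scope.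

Section UniversalProperty.
Context (k : comPzRingType) (U V W : lmodType k).

Definition bilin (f : U -> V -> W) :=
  (forall v, linear (f^~ v)) /\ (forall u, linear (f u)).

(* For f bilinear, the linear map on U ⊗ V sending u ⊗ v to f u v.  For other  *)
(* f the value depends on the chosen representative.                          *)
Definition tens_lift (f : U -> V -> W) (x : U ⊗ V) : W :=
  \sum_(p <- repr x) f p.1 p.2.

Section Bilin.
Context (f : U -> V -> W) (bf : bilin f).

Lemma bilinDl u u' v : f (u + u') v = f u v + f u' v.
Proof. by have := bf.1 v 1 u u'; rewrite /= !scale1r. Qed.

Lemma bilinDr u v v' : f u (v + v') = f u v + f u v'.
Proof. by have := bf.2 u 1 v v'; rewrite !scale1r. Qed.

Lemma bilin0l v : f 0 v = 0.
Proof. by apply: (addrI (f 0 v)); rewrite -bilinDl !addr0. Qed.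

Lemma bilin0r u : f u 0 = 0.
Proof. by apply: (addrI (f u 0)); rewrite -bilinDr !addr0. Qed.

Lemma bilinZl a u v : f (a *: u) v = a *: f u v.
Proof. by have := bf.1 v a u 0; rewrite /= bilin0l !addr0. Qed.

Lemma bilinZr a u v : f u (a *: v) = a *: f u v.
Proof. by have := bf.2 u a v 0; rewrite bilin0r !addr0. Qed.

Lemma tens_lift_pi s :
  tens_lift f (\pi_(U ⊗ V)%type s) = \sum_(p <- s) f p.1 p.2.
Proof.
rewrite /tens_lift; move: (repr _) (tens_repr s) => s' ss'.
elim: ss' => {s s'}.
- by [].
- by move=> s t _ ->.
- by move=> s t r _ -> _ ->.
- by move=> s s' t t' _ ss _ tt; rewrite !big_cat /= ss tt.
- by move=> s t; rewrite !big_cat /= addrC.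
- by move=> v; rewrite big_seq1 big_nil bilin0l.
- by move=> u u' v; rewrite !big_cons !big_nil !addr0 bilinDl.
- by move=> u v v'; rewrite !big_cons !big_nil !addr0 bilinDr.
- by move=> a u v; rewrite !big_seq1 bilinZl bilinZr.
Qed.

Lemma tens_liftE u v : tens_lift f (u ⊗ v) = f u v.
Proof. by rewrite tens_lift_pi big_seq1. Qed.

Lemma tens_lift_linear : linear (tens_lift f).
Proof.
move=> a; elim/quotW=> s; elim/quotW=> t.
rewrite [X in X + _]tens_scaleE [X in tens_lift f X]tens_addE !tens_lift_pi.
rewrite big_cat big_map scaler_sumr /=; congr (_ + _).
by apply: eq_bigr => p _; rewrite bilinZl.
Qed.

Lemma tens_lift_unique (g : {linear (U ⊗ V)%type -> W}) :
  (forall u v, g (u ⊗ v) = f u v) -> g =1 tens_lift f.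
Proof.
move=> gE; elim/tens_ind => [|u v x IHx].
  by rewrite linear0; apply: esym; rewrite -(subrr 0) -scaleN1r addrC;
     rewrite tens_lift_linear scaleN1r addNr.
by rewrite linearD gE IHx -[u ⊗ v]scale1r tens_lift_linear scale1r tens_liftE.
Qed.

End Bilin.
End UniversalProperty.

Lemma eq_tens_lift (k : comPzRingType) (U V W : lmodType k)
    (f g : U -> V -> W) : f =2 g -> tens_lift f =1 tens_lift g.
Proof. by move=> fg x; apply: eq_bigr => p _; exact: fg. Qed.

Lemma tens_bilin (k : comPzRingType) (U V : lmodType k) :
  bilin (@tens k U V).
Proof.
by split=> [v a u u'|u a v v'];
  rewrite ?tensDl ?tensDr ?tensZl ?tensZr.
Qed.

(* The algebra structure (a ⊗ b) (a' ⊗ b') = a a' ⊗ b b' on A ⊗ B.            *)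
Section TensorAlgebra.
Context (k : comPzRingType) (A B : pzAlgType k).

Definition tens_mul (x y : A ⊗ B) : A ⊗ B :=
  tens_lift (fun (a : A) (b : B) =>
    tens_lift (fun (a' : A) (b' : B) => (a * a') ⊗ (b * b')) y) x.

Lemma tens_mul_bilin_in a b :
  bilin (fun (a' : A) (b' : B) => (a * a') ⊗ (b * b')).
Proof.
split=> [v c u u'|u c v v'] /=.
  by rewrite mulrDr -pzscalerAr tensDl tensZl.
by rewrite mulrDr -pzscalerAr tensDr tensZr.
Qed.

Lemma tens_mul_bilin_out y :
  bilin (fun (a : A) (b : B) =>
    tens_lift (fun (a' : A) (b' : B) => (a * a') ⊗ (b * b')) y).
Proof.
split=> [v c u u'|u c v v'] /=; rewrite scaler_sumr -big_split /=;
  apply: eq_bigr => p _.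
  by rewrite mulrDl -pzscalerAl tensDl tensZl.
by rewrite mulrDl -pzscalerAl tensDr tensZr.
Qed.

Lemma tens_mulE a b a' b' :
  tens_mul (a ⊗ b) (a' ⊗ b') = (a * a') ⊗ (b * b').
Proof.
rewrite /tens_mul tens_liftE; last exact: tens_mul_bilin_out.
by rewrite tens_liftE //; exact: tens_mul_bilin_in.
Qed.

Lemma tens_mulPl y c x x' :
  tens_mul (c *: x + x') y = c *: tens_mul x y + tens_mul x' y.
Proof. exact: (tens_lift_linear (tens_mul_bilin_out y)). Qed.

Lemma tens_mulPr x c y y' :
  tens_mul x (c *: y + y') = c *: tens_mul x y + tens_mul x y'.
Proof.
rewrite /tens_mul {1 3 5}/tens_lift scaler_sumr -big_split /=.
by apply: eq_bigr => p _; exact: (tens_lift_linear (tens_mul_bilin_in _ _)).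
Qed.

Lemma tens_mulDl : left_distributive tens_mul +%R.
Proof. by move=> x x' y; have := tens_mulPl y 1 x x'; rewrite !scale1r. Qed.

Lemma tens_mulDr : right_distributive tens_mul +%R.
Proof. by move=> x y y'; have := tens_mulPr x 1 y y'; rewrite !scale1r. Qed.

Lemma tens_mul0l y : tens_mul 0 y = 0.
Proof. by apply: (addrI (tens_mul 0 y)); rewrite -tens_mulDl !addr0. Qed.

Lemma tens_mul0r x : tens_mul x 0 = 0.
Proof. by apply: (addrI (tens_mul x 0)); rewrite -tens_mulDr !addr0. Qed.

Lemma tens_mulA : associative tens_mul.
Proof.
move=> x y z; elim/tens_ind: x => [|a b x IHx]; first by rewrite !tens_mul0l.
rewrite !tens_mulDl IHx; congr (_ + _).
elim/tens_ind: y {x IHx} => [|c d y IHy].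
  by rewrite !(tens_mul0l, tens_mul0r).
rewrite !(tens_mulDl, tens_mulDr) IHy; congr (_ + _).
elim/tens_ind: z {y IHy} => [|e f z IHz]; first by rewrite !tens_mul0r.
by rewrite !tens_mulDr IHz !tens_mulE !mulrA.
Qed.

Lemma tens_mul1l : left_id ((1 : A) ⊗ (1 : B)) tens_mul.
Proof.
elim/tens_ind => [|a b x IHx]; first by rewrite tens_mul0r.
by rewrite tens_mulDr IHx tens_mulE !mul1r.
Qed.

Lemma tens_mul1r : right_id ((1 : A) ⊗ (1 : B)) tens_mul.
Proof.
elim/tens_ind => [|a b x IHx]; first by rewrite tens_mul0l.
by rewrite tens_mulDl IHx tens_mulE !mulr1.
Qed.

Lemma tens_mulZl c x y : c *: tens_mul x y = tens_mul (c *: x) y.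
Proof. by rewrite -[c *: x]addr0 tens_mulPl tens_mul0l addr0. Qed.

Lemma tens_mulZr c x y : c *: tens_mul x y = tens_mul x (c *: y).
Proof. by rewrite -[c *: y]addr0 tens_mulPr tens_mul0r addr0. Qed.

HB.instance Definition _ := Lmodule_isPzAlgebra.Build k (A ⊗ B)%type
  tens_mulA tens_mul1l tens_mul1r tens_mulDl tens_mulDr tens_mulZl tens_mulZr.

HB.instance Definition _ :=
  GRing.PzRing.copy (A ⊗ B)%type (PzAlgebra.sort (A ⊗ B)%type).

Lemma tensM (a a' : A) (b b' : B) :
  (a ⊗ b) * (a' ⊗ b') = (a * a') ⊗ (b * b').
Proof. exact: tens_mulE. Qed.

Lemma tens1 : (1 : A) ⊗ (1 : B) = 1.
Proof. by []. Qed.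

End TensorAlgebra.

(* In what follows every map into H ⊗ H ⊗ H = (H ⊗ H) ⊗ H is composed with     *)
(* the associativity isomorphism where needed.                                *)
Section WeakHopf.
Context (k : comPzRingType) (H : pzAlgType k).
Local Notation H2 := (H ⊗ H)%type.
Local Notation H3 := (H ⊗ H ⊗ H)%type.
Implicit Types (Delta : {linear H -> H2}) (eps : {scalar H}).
Implicit Types (S : {linear H -> H}) (x : H2).

Definition flip x : H2 := tens_lift (fun a b : H => b ⊗ a) x.

Definition leg12 x : H3 := tens_lift (fun a b : H => a ⊗ b ⊗ (1 : H)) x.
Definition leg23 x : H3 := tens_lift (fun a b : H => (1 : H) ⊗ a ⊗ b) x.
Definition leg13 x : H3 := tens_lift (fun a b : H => a ⊗ (1 : H) ⊗ b) x.

Definition comul_id Delta x : H3 :=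
  tens_lift (fun a b : H => Delta a ⊗ b) x.
Definition id_comul Delta x : H3 :=
  tens_lift (fun a b : H =>
    tens_lift (fun b1 b2 : H => a ⊗ b1 ⊗ b2) (Delta b)) x.

Definition counit_id eps x : H := tens_lift (fun a b : H => eps a *: b) x.
Definition id_counit eps x : H := tens_lift (fun a b : H => eps b *: a) x.

Definition m_antipode_id S x : H := tens_lift (fun a b : H => S a * b) x.
Definition m_id_antipode S x : H := tens_lift (fun a b : H => a * S b) x.

Definition op_comul Delta (h : H) : H2 := flip (Delta h).

(* All the maps above are values of tens_lift at bilinear functions. *)
Lemma flip_bilin : bilin (fun a b : H => b ⊗ a).
Proof.
by split=> [v c u u'|u c v v'] /=; rewrite ?(tensDl, tensDr, tensZl, tensZr).
Qed.

Lemma flipE (a b : H) : flip (a ⊗ b) = b ⊗ a.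
Proof. exact: tens_liftE flip_bilin a b. Qed.

Lemma leg12_bilin : bilin (fun a b : H => a ⊗ b ⊗ (1 : H)).
Proof.
by split=> [v c u u'|u c v v'] /=; rewrite ?(tensDl, tensDr, tensZl, tensZr).
Qed.

Lemma leg23_bilin : bilin (fun a b : H => (1 : H) ⊗ a ⊗ b).
Proof.
by split=> [v c u u'|u c v v'] /=; rewrite ?(tensDl, tensDr, tensZl, tensZr).
Qed.

Lemma leg13_bilin : bilin (fun a b : H => a ⊗ (1 : H) ⊗ b).
Proof.
by split=> [v c u u'|u c v v'] /=; rewrite ?(tensDl, tensDr, tensZl, tensZr).
Qed.

Lemma leg12E (a b : H) : leg12 (a ⊗ b) = a ⊗ b ⊗ (1 : H).
Proof. exact: tens_liftE leg12_bilin a b. Qed.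

Lemma leg23E (a b : H) : leg23 (a ⊗ b) = (1 : H) ⊗ a ⊗ b.
Proof. exact: tens_liftE leg23_bilin a b. Qed.

Lemma leg13E (a b : H) : leg13 (a ⊗ b) = a ⊗ (1 : H) ⊗ b.
Proof. exact: tens_liftE leg13_bilin a b. Qed.

Lemma comul_id_bilin Delta : bilin (fun a b : H => Delta a ⊗ b).
Proof.
by split=> [v c u u'|u c v v'] /=;
  rewrite ?linearP ?(tensDl, tensDr, tensZl, tensZr).
Qed.

Lemma assoc_bilin (a : H) : bilin (fun b1 b2 : H => a ⊗ b1 ⊗ b2).
Proof.
by split=> [v c u u'|u c v v'] /=; rewrite ?(tensDl, tensDr, tensZl, tensZr).
Qed.

Lemma id_comul_bilin Delta :
  bilin (fun a b : H =>
    tens_lift (fun b1 b2 : H => a ⊗ b1 ⊗ b2) (Delta b)).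
Proof.
split=> [v c u u'|u c v v'] /=.
  rewrite scaler_sumr -big_split /=; apply: eq_bigr => p _.
  by rewrite ?(tensDl, tensZl).
by rewrite linearP; exact: (tens_lift_linear (assoc_bilin u)).
Qed.

Lemma comul_idE Delta (a b : H) : comul_id Delta (a ⊗ b) = Delta a ⊗ b.
Proof. exact: tens_liftE (comul_id_bilin Delta) a b. Qed.

Lemma id_comulE Delta (a b : H) :
  id_comul Delta (a ⊗ b) =
  tens_lift (fun b1 b2 : H => a ⊗ b1 ⊗ b2) (Delta b).
Proof. exact: tens_liftE (id_comul_bilin Delta) a b. Qed.

Lemma counit_id_bilin eps : bilin (fun a b : H => eps a *: b).
Proof.
split=> [v c u u'|u c v v'] /=; first by rewrite linearP scalerDl scalerA.
by rewrite scalerDr !scalerA mulrC.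
Qed.

Lemma id_counit_bilin eps : bilin (fun a b : H => eps b *: a).
Proof.
split=> [v c u u'|u c v v'] /=; last by rewrite linearP scalerDl scalerA.
by rewrite scalerDr !scalerA mulrC.
Qed.

Lemma counit_idE eps (a b : H) : counit_id eps (a ⊗ b) = eps a *: b.
Proof. exact: tens_liftE (counit_id_bilin eps) a b. Qed.

Lemma id_counitE eps (a b : H) : id_counit eps (a ⊗ b) = eps b *: a.
Proof. exact: tens_liftE (id_counit_bilin eps) a b. Qed.

Lemma m_antipode_id_bilin S : bilin (fun a b : H => S a * b).
Proof.
split=> [v c u u'|u c v v'] /=; first by rewrite linearP mulrDl pzscalerAl.
by rewrite mulrDr pzscalerAr.
Qed.

Lemma m_id_antipode_bilin S : bilin (fun a b : H => a * S b).
Proof.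
split=> [v c u u'|u c v v'] /=; last by rewrite linearP mulrDr pzscalerAr.
by rewrite mulrDl pzscalerAl.
Qed.

Lemma m_antipode_idE S (a b : H) : m_antipode_id S (a ⊗ b) = S a * b.
Proof. exact: tens_liftE (m_antipode_id_bilin S) a b. Qed.

Lemma m_id_antipodeE S (a b : H) : m_id_antipode S (a ⊗ b) = a * S b.
Proof. exact: tens_liftE (m_id_antipode_bilin S) a b. Qed.

Lemma counitM12_bilin eps (h f : H) :
  bilin (fun g1 g2 : H => eps (h * g1) * eps (g2 * f) : k^o).
Proof.
split=> [v c u u'|u c v v'] /=.
  by rewrite mulrDr -pzscalerAr linearP mulrDl -mulrA.
by rewrite mulrDl -pzscalerAl linearP mulrDr mulrCA.
Qed.

Lemma counitM21_bilin eps (h f : H) :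
  bilin (fun g1 g2 : H => eps (h * g2) * eps (g1 * f) : k^o).
Proof.
split=> [v c u u'|u c v v'] /=.
  by rewrite mulrDl -pzscalerAl linearP mulrDr mulrCA.
by rewrite mulrDr -pzscalerAr linearP mulrDl -mulrA.
Qed.

Lemma antipode_mul3_bilin S :
  bilin (fun (h12 : H2) (h3 : H) => m_antipode_id S h12 * S h3).
Proof.
split=> [v c u u'|u c v v'] /=; last by rewrite linearP mulrDr pzscalerAr.
rewrite /m_antipode_id (tens_lift_linear (m_antipode_id_bilin S)).
by rewrite mulrDl pzscalerAl.
Qed.

Record weak_bialgebra Delta eps : Prop := {
  comulA : forall h, comul_id Delta (Delta h) = id_comul Delta (Delta h);
  comul_counitl : forall h, counit_id eps (Delta h) = h;
  comul_counitr : forall h, id_counit eps (Delta h) = h;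
  comulM : forall h g : H, Delta (h * g) = Delta h * Delta g;
  counitM12 : forall h g f : H, eps (h * g * f) =
    tens_lift (fun g1 g2 : H => eps (h * g1) * eps (g2 * f) : k^o) (Delta g);
  counitM21 : forall h g f : H, eps (h * g * f) =
    tens_lift (fun g1 g2 : H => eps (h * g2) * eps (g1 * f) : k^o) (Delta g);
  comul1_12_23 :
    comul_id Delta (Delta 1) = leg12 (Delta 1) * leg23 (Delta 1);
  comul1_23_12 :
    comul_id Delta (Delta 1) = leg23 (Delta 1) * leg12 (Delta 1)
}.

Record weak_hopf Delta eps S : Prop := {
  weak_hopf_bialgebra : weak_bialgebra Delta eps;
  antipode_target : forall h : H,
    m_id_antipode S (Delta h) = counit_id eps (Delta 1 * (h ⊗ (1 : H)));
  antipode_source : forall h : H,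
    m_antipode_id S (Delta h) = id_counit eps (((1 : H) ⊗ h) * Delta 1);
  antipode_mul3 : forall h : H,
    tens_lift (fun (h12 : H2) (h3 : H) => m_antipode_id S h12 * S h3)
      (comul_id Delta (Delta h)) = S h
}.

Record quasitriangular Delta eps S (R Rbar : H2) : Prop := {
  quasitriangular_weak_hopf : weak_hopf Delta eps S;
  Rmat_dom : exists x, R = op_comul Delta 1 * x * Delta 1;
  Rbar_dom : exists x, Rbar = Delta 1 * x * op_comul Delta 1;
  Rmat_Rbar : R * Rbar = op_comul Delta 1;
  Rbar_Rmat : Rbar * R = Delta 1;
  Rmat_comul : forall h : H, op_comul Delta h * R = R * Delta h;
  id_comul_Rmat : id_comul Delta R = leg13 R * leg12 R;
  comul_id_Rmat : comul_id Delta R = leg13 R * leg23 R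
}.

Record twist Delta eps (Th Thbar : H2) : Prop := {
  twist_dom : exists x, Th = Delta 1 * x;
  twistbar_dom : exists x, Thbar = x * Delta 1;
  twistK : Th * Thbar = Delta 1;
  twist_counitl : counit_id eps Th = 1;
  twist_counitr : id_counit eps Th = 1;
  twistbar_counitl : counit_id eps Thbar = 1;
  twistbar_counitr : id_counit eps Thbar = 1;
  twist_cocycle :
    comul_id Delta Th * leg12 Th = id_comul Delta Th * leg23 Th;
  twistbar_cocycle :
    leg12 Thbar * comul_id Delta Thbar = leg23 Thbar * id_comul Delta Thbar;
  twist_mixed12 :
    comul_id Delta Thbar * id_comul Delta Th = leg12 Th * leg23 Thbar;
  twist_mixed23 :
    id_comul Delta Thbar * comul_id Delta Th = leg23 Th * leg12 Thbar
}.

Definition twist_comul Delta (Th Thbar : H2) (h : H) : H2 :=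
  Thbar * Delta h * Th.

Fact twist_comul_linear Delta Th Thbar : linear (twist_comul Delta Th Thbar).
Proof.
move=> a h g; rewrite /twist_comul linearP mulrDr mulrDl.
by rewrite -pzscalerAr -pzscalerAl.
Qed.

HB.instance Definition _ Delta Th Thbar :=
  GRing.isLinear.Build k H H2 *:%R (twist_comul Delta Th Thbar)
    (twist_comul_linear Delta Th Thbar).

Definition twist_elt S (Th : H2) : H := m_antipode_id S Th.

(* vinv stands for the inverse of v. *)
Definition twist_antipode S (v vinv : H) (h : H) : H := vinv * S h * v.

Fact twist_antipode_linear S v vinv : linear (twist_antipode S v vinv).
Proof.
move=> a h g; rewrite /twist_antipode linearP mulrDr mulrDl.
by rewrite -pzscalerAr -pzscalerAl.
Qed.

HB.instance Definition _ S v vinv :=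
  GRing.isLinear.Build k H H *:%R (twist_antipode S v vinv)
    (twist_antipode_linear S v vinv).

End WeakHopf.

(* Main.v *)
Require Import Defs.
From HB Require Import structures.
From mathcomp Require Import all_boot all_order all_algebra.

Set Implicit Arguments.
Unset Strict Implicit.
Unset Printing Implicit Defensive.

Import GRing.Theory.
Local Open Scope ring_scope.

(** The twist equations say that the weak bialgebra axioms and the hexagons
    survive conjugation by a twist.  Write [v = S(Θ¹)Θ²] and [w = Θ̄¹S(Θ̄²)].

    Bialgebra part.  Coassociativity and the two product formulas for the
    iterated coproduct of 1 follow from the cocycle and mixed equations, because
    [Δ ⊗ id] and [id ⊗ Δ] are multiplicative.  The counit axioms rest on
    [counit_id_comul]: [(ε ⊗ id)(x Δ(h) y)] is the product of
    [(ε ⊗ id)(x Δ(1))], [h] and [(ε ⊗ id)(Δ(1) y)], so that for [x = Θ̄] and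
    [y = Θ] only [h] is left.

    Antipode part.  Once [S] is known to reverse products ([antipodeM]), [H ⊗ H]
    acts on [H] from the left by [x ▷ z = x¹ z S(x²)] and from the right by
    [z ◁ x = S(x¹) z x²].  In these terms the target and source counital maps
    are [Δ(h) ▷ 1] and [1 ◁ Δ(h)], [v = 1 ◁ Θ], [w = Θ̄ ▷ 1], and
    [Θ ▷ w = ΘΘ̄ ▷ 1 = 1 = v ◁ Θ̄].  Feeding the two mixed twist equations to the
    functionals [x¹ z₁ S(x²) z₂ x³] and [S(x¹) z₁ x² z₂ S(x³)] on the threefold
    tensor product ([mix3_comul], [alt3_comul_mul]) yields [w v = 1], [v w = 1]
    and the antipode axioms of the twisted structure.

    R-matrix part.  The equations for a single coproduct are cancellations
    between adjacent twists.  In the hexagon for [id ⊗ Δ], the R-matrix is moved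
    past the twists by [Δᵒᵖ(h) R = R Δ(h)], after which the cocycle equations and
    one mixed equation, with their tensor factors permuted, regroup the twists
    ([id_comul_twistR]).

    Reversing the coproduct turns weak bialgebras, twists and the R-matrix
    equations into such data again, exchanging the counit conditions on the two
    tensor factors and the two hexagons ([weak_bialgebra_op], [twist_op]); this
    gives the second half of both parts from the first. *)

(** * Linear maps out of tensor products *)

Section TensorExtras.
Context (k : comPzRingType) (U V : lmodType k).

Lemma tens0l (v : V) : (0 : U) ⊗ v = 0.
Proof. exact: (bilin0l (tens_bilin U V)). Qed.

Lemma tens_liftD (W : lmodType k) (f : U -> V -> W) :
  bilin f -> {morph tens_lift f : x y / x + y}.
Proof.
by move=> bf x y; have := tens_lift_linear bf 1 x y; rewrite !scale1r.
Qed.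

Lemma tens_lift0 (W : lmodType k) (f : U -> V -> W) :
  bilin f -> tens_lift f 0 = 0.
Proof.
move=> bf; apply: (addrI (tens_lift f 0)).
by rewrite -(tens_liftD bf) !addr0.
Qed.

Lemma tens0r (u : U) : u ⊗ (0 : V) = 0.
Proof. exact: (bilin0r (tens_bilin U V)). Qed.

End TensorExtras.

Section ScalarsOut.
Context (k : comPzRingType) (A : pzAlgType k).

Lemma pzscaleMl (a : k) (x y : A) : (a *: x) * y = a *: (x * y).
Proof. by rewrite pzscalerAl. Qed.

Lemma pzscaleMr (a : k) (x y : A) : x * (a *: y) = a *: (x * y).
Proof. by rewrite pzscalerAr. Qed.

End ScalarsOut.

(* Distributes every linear operation in sight over sums. *)
Ltac linE := rewrite ?(linearD, linear0, mulrDl, mulrDr, mul0r, mulr0, tensDl,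
  tensDr, tens0l, tens0r, scalerDl, scalerDr, scaler0, scale0r, addr0) /=.

(* Reduces an identity additive in the tensor x to the case of a pure tensor
   u ⊗ v; the other variables of the goal stay fixed. *)
Tactic Notation "tens_induct" ident(x) "as" ident(u) ident(v) :=
  let IH := fresh "IH" in
  let y := fresh "y" in
  elim/tens_ind: x => [|u v y IH];
  [by linE | linE; rewrite ?{}IH; congr (_ + _); clear y].

Ltac bilin_tac :=
  split=> [v c u u'|u c v v'] /=;
  by rewrite ?(linearP, mulrDl, mulrDr, pzscaleMl, pzscaleMr, tensDl, tensDr,
               tensZl, tensZr).

Section LinearMaps.
Context (k : comPzRingType) (H : pzAlgType k).
Local Notation H2 := (H ⊗ H)%type.
Local Notation H3 := (H ⊗ H ⊗ H)%type.

HB.instance Definition _ := GRing.isLinear.Build k H2 H2 *:%R (@flip k H)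
  (tens_lift_linear (flip_bilin H)).
HB.instance Definition _ := GRing.isLinear.Build k H2 H3 *:%R (@leg12 k H)
  (tens_lift_linear (leg12_bilin H)).
HB.instance Definition _ := GRing.isLinear.Build k H2 H3 *:%R (@leg23 k H)
  (tens_lift_linear (leg23_bilin H)).
HB.instance Definition _ := GRing.isLinear.Build k H2 H3 *:%R (@leg13 k H)
  (tens_lift_linear (leg13_bilin H)).

Section StructureMaps.
Context (Delta : {linear H -> H2}) (eps : {scalar H}) (S : {linear H -> H}).

HB.instance Definition _ := GRing.isLinear.Build k H2 H3 *:%R
  (comul_id Delta) (tens_lift_linear (comul_id_bilin Delta)).
HB.instance Definition _ := GRing.isLinear.Build k H2 H3 *:%R
  (id_comul Delta) (tens_lift_linear (id_comul_bilin Delta)).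
HB.instance Definition _ := GRing.isLinear.Build k H2 H *:%R
  (counit_id eps) (tens_lift_linear (counit_id_bilin eps)).
HB.instance Definition _ := GRing.isLinear.Build k H2 H *:%R
  (id_counit eps) (tens_lift_linear (id_counit_bilin eps)).
HB.instance Definition _ := GRing.isLinear.Build k H2 H *:%R
  (m_antipode_id S) (tens_lift_linear (m_antipode_id_bilin S)).
HB.instance Definition _ := GRing.isLinear.Build k H2 H *:%R
  (m_id_antipode S) (tens_lift_linear (m_id_antipode_bilin S)).

Fact op_comul_linear : linear (op_comul Delta).
Proof. by move=> a x y; rewrite /op_comul !linearP. Qed.

HB.instance Definition _ := GRing.isLinear.Build k H H2 *:%R
  (op_comul Delta) op_comul_linear.

End StructureMaps.

(** Written through products so that bilinearity is a matter of rewriting. *)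
Definition rev3 (X : H3) : H3 :=
  tens_lift (fun (u : H2) (c : H) => (c ⊗ (1 : H) ⊗ (1 : H)) * leg23 (flip u)) X.
Definition cyc3 (X : H3) : H3 :=
  tens_lift (fun (u : H2) (c : H) => (c ⊗ (1 : H) ⊗ (1 : H)) * leg23 u) X.
Definition swap12 (X : H3) : H3 :=
  tens_lift (fun (u : H2) (c : H) => flip u ⊗ c) X.

Lemma rev3_bilin :
  bilin (fun (u : H2) (c : H) => (c ⊗ (1 : H) ⊗ (1 : H)) * leg23 (flip u)).
Proof. bilin_tac. Qed.
HB.instance Definition _ := GRing.isLinear.Build k H3 H3 *:%R rev3
  (tens_lift_linear rev3_bilin).

Lemma cyc3_bilin :
  bilin (fun (u : H2) (c : H) => (c ⊗ (1 : H) ⊗ (1 : H)) * leg23 u).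
Proof. bilin_tac. Qed.
HB.instance Definition _ := GRing.isLinear.Build k H3 H3 *:%R cyc3
  (tens_lift_linear cyc3_bilin).

Lemma swap12_bilin : bilin (fun (u : H2) (c : H) => flip u ⊗ c).
Proof. bilin_tac. Qed.
HB.instance Definition _ := GRing.isLinear.Build k H3 H3 *:%R swap12
  (tens_lift_linear swap12_bilin).

Lemma rev3E a b c : rev3 (a ⊗ b ⊗ c) = c ⊗ b ⊗ a.
Proof.
by rewrite /rev3 (tens_liftE rev3_bilin) flipE leg23E !tensM !mul1r mulr1.
Qed.

Lemma cyc3E a b c : cyc3 (a ⊗ b ⊗ c) = c ⊗ a ⊗ b.
Proof.
by rewrite /cyc3 (tens_liftE cyc3_bilin) leg23E !tensM !mul1r mulr1.
Qed.

Lemma swap12E (u : H2) c : swap12 (u ⊗ c) = flip u ⊗ c.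
Proof. by rewrite /swap12 (tens_liftE swap12_bilin). Qed.

End LinearMaps.

(* Evaluates the structure maps on pure tensors. *)
Ltac pureE := rewrite /= ?(tensM, flipE, leg12E, leg23E, leg13E, rev3E, cyc3E,
  swap12E, comul_idE, counit_idE, id_counitE, mul1r, mulr1) /=.

(** * Permutations of tensor factors and leg maps *)

Section Permutations.
Context (k : comPzRingType) (H : pzAlgType k).
Local Notation H2 := (H ⊗ H)%type.
Local Notation H3 := (H ⊗ H ⊗ H)%type.

Lemma flipM (x y : H2) : flip (x * y) = flip x * flip y.
Proof. by tens_induct x as a b; tens_induct y as c d; pureE. Qed.

Lemma flipK (x : H2) : flip (flip x) = x.
Proof. by tens_induct x as a b; pureE. Qed.

Lemma rev3M (X Y : H3) : rev3 (X * Y) = rev3 X * rev3 Y.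
Proof.
tens_induct X as u c; tens_induct u as a b.
by tens_induct Y as v f; tens_induct v as d e; pureE.
Qed.

Lemma rev3K (X : H3) : rev3 (rev3 X) = X.
Proof. by tens_induct X as u c; tens_induct u as a b; pureE. Qed.

Lemma cyc3M (X Y : H3) : cyc3 (X * Y) = cyc3 X * cyc3 Y.
Proof.
tens_induct X as u c; tens_induct u as a b.
by tens_induct Y as v f; tens_induct v as d e; pureE.
Qed.

Lemma swap12M (X Y : H3) : swap12 (X * Y) = swap12 X * swap12 Y.
Proof.
by tens_induct X as u c; tens_induct Y as v f; pureE; rewrite flipM.
Qed.

Lemma leg12M (x y : H2) : leg12 (x * y) = leg12 x * leg12 y.
Proof. by tens_induct x as a b; tens_induct y as c d; pureE. Qed.

Lemma leg23M (x y : H2) : leg23 (x * y) = leg23 x * leg23 y.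
Proof. by tens_induct x as a b; tens_induct y as c d; pureE. Qed.

Lemma leg13M (x y : H2) : leg13 (x * y) = leg13 x * leg13 y.
Proof. by tens_induct x as a b; tens_induct y as c d; pureE. Qed.

Lemma leg12_tens (u : H2) : leg12 u = u ⊗ (1 : H).
Proof. by tens_induct u as a b; pureE. Qed.

Lemma rev3_leg12 (x : H2) : rev3 (leg12 x) = leg23 (flip x).
Proof. by tens_induct x as a b; pureE. Qed.

Lemma rev3_leg23 (x : H2) : rev3 (leg23 x) = leg12 (flip x).
Proof. by tens_induct x as a b; pureE. Qed.

Lemma rev3_leg13 (x : H2) : rev3 (leg13 x) = leg13 (flip x).
Proof. by tens_induct x as a b; pureE. Qed.

Lemma cyc3_leg12 (x : H2) : cyc3 (leg12 x) = leg23 x.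
Proof. by tens_induct x as a b; pureE. Qed.

Lemma cyc3_leg23 (x : H2) : cyc3 (leg23 x) = leg13 (flip x).
Proof. by tens_induct x as a b; pureE. Qed.

Lemma swap12_leg12 (x : H2) : swap12 (leg12 x) = leg12 (flip x).
Proof. by tens_induct x as a b; pureE. Qed.

Lemma swap12_leg23 (x : H2) : swap12 (leg23 x) = leg13 x.
Proof. by tens_induct x as a b; pureE. Qed.

(** The reassociated tensor [a ⊗ Δ(b)] becomes a product, and [Δ(b)] is exposed
    as a single tensor variable on which induction is possible. *)
Lemma id_comul_tens (Delta : {linear H -> H2}) a b :
  id_comul Delta (a ⊗ b) = (a ⊗ (1 : H) ⊗ (1 : H)) * leg23 (Delta b).
Proof.
rewrite id_comulE; elim/tens_ind: (Delta b) => [|c d u IH].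
  by rewrite (tens_lift0 (assoc_bilin a)) linear0 mulr0.
by rewrite (tens_liftD (assoc_bilin a)) (tens_liftE (assoc_bilin a)) IH
  linearD mulrDr; pureE.
Qed.

Section Comultiplicative.
Context (Delta : {linear H -> H2}).
Context (DeltaM : forall h g : H, Delta (h * g) = Delta h * Delta g).

Lemma comul_idM (x y : H2) :
  comul_id Delta (x * y) = comul_id Delta x * comul_id Delta y.
Proof.
by tens_induct x as a b; tens_induct y as c d; pureE; rewrite DeltaM.
Qed.

Lemma id_comulM (x y : H2) :
  id_comul Delta (x * y) = id_comul Delta x * id_comul Delta y.
Proof.
tens_induct x as a b; tens_induct y as c d.
rewrite tensM !id_comul_tens DeltaM leg23M.
move: (Delta b) (Delta d) => u v.
tens_induct u as e f; tens_induct v as g h.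
by pureE.
Qed.

End Comultiplicative.

Lemma op_comulE (Delta : {linear H -> H2}) h :
  op_comul Delta h = flip (Delta h).
Proof. by []. Qed.

Lemma rev3_id_comul (Delta : {linear H -> H2}) (x : H2) :
  rev3 (id_comul Delta x) = comul_id (op_comul Delta) (flip x).
Proof.
tens_induct x as a b; pureE; rewrite id_comul_tens /= op_comulE.
by move: (Delta b) => u; tens_induct u as c d; pureE.
Qed.

Lemma rev3_comul_id (Delta : {linear H -> H2}) (x : H2) :
  rev3 (comul_id Delta x) = id_comul (op_comul Delta) (flip x).
Proof.
tens_induct x as a b; pureE; rewrite id_comul_tens /= op_comulE.
by move: (Delta a) => u; tens_induct u as c d; pureE.
Qed.

Lemma counit_id_flip (eps : {scalar H}) (x : H2) :
  counit_id eps (flip x) = id_counit eps x.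
Proof. by tens_induct x as a b; pureE. Qed.

Lemma id_counit_flip (eps : {scalar H}) (x : H2) :
  id_counit eps (flip x) = counit_id eps x.
Proof. by tens_induct x as a b; pureE. Qed.

End Permutations.

(** * Counits in weak bialgebras *)

Section InnerCounits.
Context (k : comPzRingType) (H : pzAlgType k).
Local Notation H2 := (H ⊗ H)%type.
Local Notation H3 := (H ⊗ H ⊗ H)%type.
Local Notation "1" := (GRing.one H) (only parsing) : ring_scope.
Context (eps : {scalar H}).

Definition counit1 (X : H3) : H2 :=
  tens_lift (fun (u : H2) (c : H) => counit_id eps u ⊗ c) X.
Definition counit2 (X : H3) : H2 :=
  tens_lift (fun (u : H2) (c : H) => id_counit eps u ⊗ c) X.
Definition counit3 (X : H3) : H2 :=
  tens_lift (fun (u : H2) (c : H) => eps c *: u) X.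

Lemma counit1_bilin : bilin (fun (u : H2) (c : H) => counit_id eps u ⊗ c).
Proof. bilin_tac. Qed.
HB.instance Definition _ := GRing.isLinear.Build k H3 H2 *:%R counit1
  (tens_lift_linear counit1_bilin).

Lemma counit2_bilin : bilin (fun (u : H2) (c : H) => id_counit eps u ⊗ c).
Proof. bilin_tac. Qed.
HB.instance Definition _ := GRing.isLinear.Build k H3 H2 *:%R counit2
  (tens_lift_linear counit2_bilin).

Lemma counit3_bilin : bilin (fun (u : H2) (c : H) => eps c *: u).
Proof.
split=> [v c u u'|u c v v'] /=; first by rewrite scalerDr !scalerA mulrC.
by rewrite linearP scalerDl -scalerA.
Qed.
HB.instance Definition _ := GRing.isLinear.Build k H3 H2 *:%R counit3
  (tens_lift_linear counit3_bilin).

Lemma counit1E u c : counit1 (u ⊗ c) = counit_id eps u ⊗ c.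
Proof. by rewrite /counit1 (tens_liftE counit1_bilin). Qed.
Lemma counit2E u c : counit2 (u ⊗ c) = id_counit eps u ⊗ c.
Proof. by rewrite /counit2 (tens_liftE counit2_bilin). Qed.
Lemma counit3E u c : counit3 (u ⊗ c) = eps c *: u.
Proof. by rewrite /counit3 (tens_liftE counit3_bilin). Qed.

Lemma eps_id_counit (x : H2) : eps (id_counit eps x) = eps (counit_id eps x).
Proof. by tens_induct x as a b; pureE; rewrite !linearZ /= mulrC. Qed.

Lemma counit_id_mull a b (x : H2) :
  counit_id eps ((a ⊗ b) * x) = b * counit_id eps ((a ⊗ 1) * x).
Proof. by tens_induct x as c d; pureE; rewrite pzscaleMr. Qed.

Lemma counit_id_mulr a b (x : H2) :
  counit_id eps (x * (a ⊗ b)) = counit_id eps (x * (a ⊗ 1)) * b.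
Proof. by tens_induct x as c d; pureE; rewrite pzscaleMl. Qed.

Lemma counit_id_mul1r b (x : H2) :
  counit_id eps (x * (1 ⊗ b)) = counit_id eps x * b.
Proof. by rewrite counit_id_mulr tens1 mulr1. Qed.

Lemma counit_id_mul1l b (x : H2) :
  counit_id eps ((1 ⊗ b) * x) = b * counit_id eps x.
Proof. by rewrite counit_id_mull tens1 mul1r. Qed.

End InnerCounits.

Section WeakBialgebra.
Context (k : comPzRingType) (H : pzAlgType k).
Local Notation H2 := (H ⊗ H)%type.
Local Notation H3 := (H ⊗ H ⊗ H)%type.
Local Notation "1" := (GRing.one H) (only parsing) : ring_scope.
Context (Delta : {linear H -> H2}) (eps : {scalar H}).

(** The weak multiplicativity axioms for the counit, once expressed through
    products in [H ⊗ H], can be combined with the algebra of leg maps. *)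
Lemma counitM12_lift (h f : H) (x : H2) :
  tens_lift (fun g1 g2 : H => eps (h * g1) * eps (g2 * f) : k^o) x =
  eps (counit_id eps ((h ⊗ 1) * x * (1 ⊗ f))).
Proof.
elim/tens_ind: x => [|a b x IH].
  by rewrite (tens_lift0 (counitM12_bilin eps h f)); linE.
rewrite (tens_liftD (counitM12_bilin eps h f)) IH.
rewrite (tens_liftE (counitM12_bilin eps h f)); linE; congr (_ + _).
by pureE; rewrite linearZ.
Qed.

Lemma counitM21_lift (h f : H) (x : H2) :
  tens_lift (fun g1 g2 : H => eps (h * g2) * eps (g1 * f) : k^o) x =
  eps (counit_id eps ((1 ⊗ h) * x * (f ⊗ 1))).
Proof.
elim/tens_ind: x => [|a b x IH].
  by rewrite (tens_lift0 (counitM21_bilin eps h f)); linE.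
rewrite (tens_liftD (counitM21_bilin eps h f)) IH.
rewrite (tens_liftE (counitM21_bilin eps h f)); linE; congr (_ + _).
by pureE; rewrite linearZ /= mulrC.
Qed.

Context (W : weak_bialgebra Delta eps).

Lemma eps_mul12 h g f :
  eps (h * g * f) = eps (counit_id eps ((h ⊗ 1) * Delta g * (1 ⊗ f))).
Proof. by rewrite -counitM12_lift; exact: counitM12 W h g f. Qed.

Lemma eps_mul21 h g f :
  eps (h * g * f) = eps (counit_id eps ((1 ⊗ h) * Delta g * (f ⊗ 1))).
Proof. by rewrite -counitM21_lift; exact: counitM21 W h g f. Qed.

Lemma comul1l h : Delta 1 * Delta h = Delta h.
Proof. by rewrite -(comulM W) mul1r. Qed.

Lemma comul1r h : Delta h * Delta 1 = Delta h.
Proof. by rewrite -(comulM W) mulr1. Qed.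

Lemma id_comul1_12_23 : id_comul Delta (Delta 1) = leg12 (Delta 1) * leg23 (Delta 1).
Proof. by rewrite -(comulA W) (comul1_12_23 W). Qed.

Lemma id_comul1_23_12 : id_comul Delta (Delta 1) = leg23 (Delta 1) * leg12 (Delta 1).
Proof. by rewrite -(comulA W) (comul1_23_12 W). Qed.

Lemma id_comul_1tens h : id_comul Delta (1 ⊗ h) = leg23 (Delta h).
Proof. by rewrite id_comul_tens tens1 mul1r. Qed.

Lemma counit2_id_comul a b (y : H2) :
  counit2 eps ((a ⊗ 1 ⊗ 1) * id_comul Delta y * (b ⊗ 1 ⊗ 1)) =
  (a ⊗ 1) * y * (b ⊗ 1).
Proof.
tens_induct y as c d; rewrite id_comul_tens.
have -> : (a ⊗ 1) * (c ⊗ d) * (b ⊗ 1) =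
          (a * c * b) ⊗ counit_id eps (Delta d).
  by rewrite (comul_counitl W); pureE.
move: (Delta d) => u; tens_induct u as e f; pureE.
by rewrite counit2E; pureE; rewrite tensZr tensZl.
Qed.

(** Splitting [ε (a h₁)] at 1 produces [1₁ ⊗ 1₂ h₁ ⊗ h₂], which is
    [(id ⊗ Δ)(Δ(1)(1 ⊗ h))]; the counit of the inner coproduct then cancels. *)
Lemma counit_id_comulr a h :
  counit_id eps ((a ⊗ 1) * Delta h) = counit_id eps ((a ⊗ 1) * Delta 1) * h.
Proof.
have M12 (Z : H2) : counit_id eps ((a ⊗ 1) * Z) =
    counit_id eps (counit2 eps ((a ⊗ 1 ⊗ 1) * (leg12 (Delta 1) * leg23 Z))).
  tens_induct Z as p q; pureE.
  rewrite -[a in LHS]mulr1 eps_mul12 leg12_tens -eps_id_counit.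
  by move: (Delta 1) => u; tens_induct u as c d; pureE; rewrite counit2E; pureE;
    rewrite linearZ /=.
have E : leg12 (Delta 1) * leg23 (Delta h) =
    id_comul Delta (Delta 1 * (1 ⊗ h)).
  by rewrite -[in LHS](comul1l h) leg23M mulrA -id_comul1_12_23
    -id_comul_1tens -(id_comulM (comulM W)).
rewrite M12 E -[_ * id_comul _ _]mulr1.
by rewrite counit2_id_comul mulr1 mulrA counit_id_mul1r.
Qed.

Lemma counit_id_comull a h :
  counit_id eps (Delta h * (a ⊗ 1)) = h * counit_id eps (Delta 1 * (a ⊗ 1)).
Proof.
have M21 (Z : H2) : counit_id eps (Z * (a ⊗ 1)) =
    counit_id eps (counit2 eps ((leg23 Z * leg12 (Delta 1)) * (a ⊗ 1 ⊗ 1))).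
  tens_induct Z as p q; pureE.
  rewrite -[p in LHS]mulr1 eps_mul21 leg12_tens -eps_id_counit.
  by move: (Delta 1) => u; tens_induct u as c d; pureE; rewrite counit2E; pureE;
    rewrite linearZ /=.
have E : leg23 (Delta h) * leg12 (Delta 1) =
    id_comul Delta ((1 ⊗ h) * Delta 1).
  by rewrite -[in LHS](comul1r h) leg23M -mulrA -id_comul1_23_12
    -id_comul_1tens -(id_comulM (comulM W)).
rewrite M21 E -[id_comul _ _]mul1r.
by rewrite counit2_id_comul mul1r -mulrA counit_id_mul1l.
Qed.

(** The counit axiom splits [ε (x¹ h₁ y¹)] into [ε (x¹ h₁) ε (h₂ y¹)], after
    which each half involves only one of [x] and [y]. *)
Lemma counit_id_comul (x y : H2) h :
  counit_id eps (x * Delta h * y) =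
  counit_id eps (x * Delta 1) * h * counit_id eps (Delta 1 * y).
Proof.
tens_induct x as a a'; tens_induct y as b b'.
rewrite counit_id_mulr (counit_id_mulr _ b b') (counit_id_mull _ a a') -mulrA.
rewrite counit_id_mull -!mulrA; congr (_ * _); rewrite !mulrA; congr (_ * _).
have M12 (Z : H2) : counit_id eps ((a ⊗ 1) * Z * (b ⊗ 1)) =
    counit_id eps (counit2 eps
      ((a ⊗ 1 ⊗ 1) * comul_id Delta Z * (1 ⊗ b ⊗ 1))).
  tens_induct Z as p q; pureE; rewrite eps_mul12 -eps_id_counit.
  by move: (Delta p) => u; tens_induct u as c d; pureE; rewrite counit2E; pureE;
    rewrite linearZ /=.
have C (Z : H2) :
    counit2 eps ((a ⊗ 1 ⊗ 1) * id_comul Delta Z * (1 ⊗ b ⊗ 1)) =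
    (a ⊗ 1) * Z * (1 ⊗ counit_id eps (Delta 1 * (b ⊗ 1))).
  tens_induct Z as p q; pureE; rewrite -counit_id_comull id_comul_tens.
  move: (Delta q) => u; tens_induct u as c d; pureE.
  by rewrite counit2E; pureE; rewrite tensZr tensZl.
by rewrite M12 (comulA W) C counit_id_mul1r counit_id_comulr.
Qed.

(** Under [ε], an element cannot be told apart from its counital projections. *)
Lemma eps_target a b : eps (a * counit_id eps (Delta 1 * (b ⊗ 1))) = eps (a * b).
Proof. by rewrite -{2}[a]mulr1 eps_mul21 -mulrA counit_id_mul1l. Qed.

Lemma eps_target_op a b :
  eps (counit_id eps ((a ⊗ 1) * Delta 1) * b) = eps (a * b).
Proof. by rewrite -{2}[a]mulr1 eps_mul12 counit_id_mul1r. Qed.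

(** Elements [ε(a 1₁ b) 1₂] of the target base: applying [ε (a _ b)] to the
    first factor of the iterated coproduct of 1 gives their coproduct, and the
    two product formulas for that iterated coproduct give the two sides. *)
Lemma comul_counit_id1 a b :
  let t := counit_id eps ((a ⊗ 1) * Delta 1 * (b ⊗ 1)) in
  Delta t = Delta 1 * (t ⊗ 1) /\ Delta t = (t ⊗ 1) * Delta 1.
Proof.
move=> t.
have Dt : Delta t = counit1 eps
    ((a ⊗ 1 ⊗ 1) * id_comul Delta (Delta 1) * (b ⊗ 1 ⊗ 1)).
  rewrite /t; move: (Delta 1) => x; tens_induct x as c d; pureE.
  rewrite linearZ id_comul_tens /=; move: (Delta d) => u.
  tens_induct u as e f; pureE; rewrite counit1E; pureE; rewrite tensZl.
  by [].
split.
  rewrite Dt id_comul1_23_12 /t; move: (Delta 1) => u.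
  have G (x y : H2) : counit1 eps
      ((a ⊗ 1 ⊗ 1) * (leg23 x * leg12 y) * (b ⊗ 1 ⊗ 1)) =
      x * (counit_id eps ((a ⊗ 1) * y * (b ⊗ 1)) ⊗ 1).
    tens_induct x as c d; tens_induct y as e f; pureE.
    by rewrite counit1E; pureE; rewrite !(tensZl, pzscaleMr); pureE.
  exact: G.
rewrite Dt id_comul1_12_23 /t; move: (Delta 1) => u.
have G (x y : H2) : counit1 eps
    ((a ⊗ 1 ⊗ 1) * (leg12 x * leg23 y) * (b ⊗ 1 ⊗ 1)) =
    (counit_id eps ((a ⊗ 1) * x * (b ⊗ 1)) ⊗ 1) * y.
  tens_induct x as c d; tens_induct y as e f; pureE.
  by rewrite counit1E; pureE; rewrite !(tensZl, pzscaleMl); pureE.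
exact: G.
Qed.

End WeakBialgebra.

(** * The coopposite weak bialgebra *)

Section Coopposite.
Context (k : comPzRingType) (H : pzAlgType k).
Local Notation H2 := (H ⊗ H)%type.
Local Notation H3 := (H ⊗ H ⊗ H)%type.
Local Notation "1" := (GRing.one H) (only parsing) : ring_scope.
Context (Delta : {linear H -> H2}) (eps : {scalar H}).
Context (W : weak_bialgebra Delta eps).

Lemma flip_1tens a : flip (1 ⊗ a) = a ⊗ 1.
Proof. by pureE. Qed.

Lemma weak_bialgebra_op : weak_bialgebra (op_comul Delta) eps.
Proof.
have flip_sum h f (x : H2) :
    eps (counit_id eps ((h ⊗ 1) * flip x * (1 ⊗ f))) =
    eps (counit_id eps ((1 ⊗ h) * x * (f ⊗ 1))).
  rewrite -[x in RHS]flipK -(flipE 1 f) -(flipE h 1) -!flipM counit_id_flip.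
  by rewrite eps_id_counit.
split=> [h|h|h|h g|h g f|h g f||] /=.
- by rewrite !op_comulE -rev3_id_comul -rev3_comul_id (comulA W).
- by rewrite op_comulE counit_id_flip (comul_counitr W).
- by rewrite op_comulE id_counit_flip (comul_counitl W).
- by rewrite !op_comulE (comulM W) flipM.
- by rewrite counitM12_lift op_comulE flip_sum (eps_mul21 W).
- rewrite counitM21_lift op_comulE -flip_sum flipK.
  by rewrite (eps_mul12 W).
- rewrite !op_comulE -rev3_id_comul -(comulA W) (comul1_23_12 W).
  by rewrite rev3M rev3_leg12 rev3_leg23.
- rewrite !op_comulE -rev3_id_comul -(comulA W) (comul1_12_23 W).
  by rewrite rev3M rev3_leg12 rev3_leg23.
Qed.

Lemma id_counit_comul (x y : H2) h :
  id_counit eps (x * Delta h * y) =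
  id_counit eps (x * Delta 1) * h * id_counit eps (Delta 1 * y).
Proof.
rewrite -!counit_id_flip !flipM -!op_comulE.
exact: counit_id_comul weak_bialgebra_op (flip x) (flip y) h.
Qed.

Lemma eps_source a b : eps (id_counit eps ((1 ⊗ a) * Delta 1) * b) = eps (a * b).
Proof.
rewrite -counit_id_flip flipM flip_1tens -op_comulE.
exact: eps_target_op weak_bialgebra_op a b.
Qed.

Lemma eps_source_op a b :
  eps (a * id_counit eps (Delta 1 * (1 ⊗ b))) = eps (a * b).
Proof.
rewrite -counit_id_flip flipM flip_1tens -op_comulE.
exact: eps_target weak_bialgebra_op a b.
Qed.

Lemma comul_id_counit1 a b :
  let s := id_counit eps ((1 ⊗ a) * Delta 1 * (1 ⊗ b)) in
  Delta s = Delta 1 * (1 ⊗ s) /\ Delta s = (1 ⊗ s) * Delta 1.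
Proof.
move=> s; have /= [] := comul_counit_id1 weak_bialgebra_op a b.
rewrite -!flip_1tens !op_comulE -!flipM counit_id_flip -/s.
by move=> /(can_inj (@flipK _ _)) E1 /(can_inj (@flipK _ _)) E2.
Qed.

Lemma id_counit_mul1r b (x : H2) :
  id_counit eps (x * (b ⊗ 1)) = id_counit eps x * b.
Proof. by tens_induct x as c d; pureE; rewrite pzscaleMl. Qed.

Lemma id_counit_mul1l b (x : H2) :
  id_counit eps ((b ⊗ 1) * x) = b * id_counit eps x.
Proof. by tens_induct x as c d; pureE; rewrite pzscaleMr. Qed.

End Coopposite.

(** * The twisted weak bialgebra *)

Section Twist.
Context (k : comPzRingType) (H : pzAlgType k).
Local Notation H2 := (H ⊗ H)%type.
Local Notation H3 := (H ⊗ H ⊗ H)%type.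
Local Notation "1" := (GRing.one H) (only parsing) : ring_scope.

Lemma comul_id_twist (Delta : {linear H -> H2}) (Th Thbar x : H2) :
  comul_id (twist_comul Delta Th Thbar) x =
  leg12 Thbar * comul_id Delta x * leg12 Th.
Proof. by tens_induct x as a b; rewrite !leg12_tens; pureE. Qed.

Lemma leg23_tens1 a (u : H2) : leg23 u * (a ⊗ 1 ⊗ 1) = (a ⊗ 1 ⊗ 1) * leg23 u.
Proof. by tens_induct u as b c; pureE. Qed.

Lemma id_comul_twist (Delta : {linear H -> H2}) (Th Thbar x : H2) :
  id_comul (twist_comul Delta Th Thbar) x =
  leg23 Thbar * id_comul Delta x * leg23 Th.
Proof.
tens_induct x as a b; rewrite !id_comul_tens /= /twist_comul.
by rewrite !leg23M !mulrA leg23_tens1.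
Qed.

Lemma flip_twist_comul (Delta : {linear H -> H2}) (Th Thbar : H2) h :
  flip (twist_comul Delta Th Thbar h) =
  twist_comul (op_comul Delta) (flip Th) (flip Thbar) h.
Proof. by rewrite /twist_comul !flipM. Qed.

Lemma twist_op (Delta : {linear H -> H2}) (eps : {scalar H}) (Th Thbar : H2) :
  twist Delta eps Th Thbar -> twist (op_comul Delta) eps (flip Th) (flip Thbar).
Proof.
move=> T; split.
- by case: (twist_dom T) => x ->; exists (flip x); rewrite flipM.
- by case: (twistbar_dom T) => x ->; exists (flip x); rewrite flipM.
- by rewrite -flipM (twistK T).
- by rewrite counit_id_flip (twist_counitr T).
- by rewrite id_counit_flip (twist_counitl T).
- by rewrite counit_id_flip (twistbar_counitr T).
- by rewrite id_counit_flip (twistbar_counitl T).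
- rewrite -rev3_id_comul -rev3_comul_id -rev3_leg12 -rev3_leg23 -!rev3M.
  by rewrite (twist_cocycle T).
- rewrite -rev3_id_comul -rev3_comul_id -rev3_leg12 -rev3_leg23 -!rev3M.
  by rewrite (twistbar_cocycle T).
- rewrite -rev3_id_comul -rev3_comul_id -rev3_leg12 -rev3_leg23 -!rev3M.
  by rewrite (twist_mixed23 T).
- rewrite -rev3_id_comul -rev3_comul_id -rev3_leg12 -rev3_leg23 -!rev3M.
  by rewrite (twist_mixed12 T).
Qed.

Section TwistedBialgebra.
Context (Delta : {linear H -> H2}) (eps : {scalar H}) (Th Thbar : H2).
Context (W : weak_bialgebra Delta eps) (T : twist Delta eps Th Thbar).

Lemma comul1_twist : Delta 1 * Th = Th.
Proof. by case: (twist_dom T) => x ->; rewrite mulrA (comul1l W). Qed.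

Lemma twistbar_comul1 : Thbar * Delta 1 = Thbar.
Proof. by case: (twistbar_dom T) => x ->; rewrite -mulrA (comul1r W). Qed.

Lemma twist_comul1 : twist_comul Delta Th Thbar 1 = Thbar * Th.
Proof. by rewrite /twist_comul twistbar_comul1. Qed.

Lemma twist_comulM h g : twist_comul Delta Th Thbar (h * g) =
  twist_comul Delta Th Thbar h * twist_comul Delta Th Thbar g.
Proof.
rewrite /twist_comul -!mulrA (mulrA Th) (twistK T) (mulrA (Delta 1)).
by rewrite (comul1l W) (comulM W) !mulrA.
Qed.

Lemma twist_comul_counit_id h :
  counit_id eps (twist_comul Delta Th Thbar h) = h.
Proof.
rewrite /twist_comul (counit_id_comul W) twistbar_comul1 comul1_twist.
by rewrite (twist_counitl T) (twistbar_counitl T) mulr1 mul1r.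
Qed.

(** By [id_counit_comul], [Θ̄¹ ε(Θ̄² z)] equals [1₁ ε(1₂ z)], so [Θ̄] acts here
    like [Δ(1)]. *)
Lemma eps_twistbar h z :
  eps (counit_id eps ((h ⊗ 1) * Thbar) * z) = eps (h * z).
Proof.
have E : id_counit eps (Thbar * (1 ⊗ z)) = id_counit eps (Delta 1 * (1 ⊗ z)).
  rewrite -[Thbar in LHS]twistbar_comul1 (id_counit_comul W) twistbar_comul1.
  by rewrite (twistbar_counitr T) !mul1r.
rewrite -counit_id_mul1r -eps_id_counit -mulrA id_counit_mul1l E.
exact: eps_source_op W h z.
Qed.

Lemma twist_eps_mul12 h g f : eps (h * g * f) =
  eps (counit_id eps ((h ⊗ 1) * twist_comul Delta Th Thbar g * (1 ⊗ f))).
Proof.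
rewrite /twist_comul counit_id_mul1r !mulrA (counit_id_comul W).
rewrite -[_ * Thbar * _]mulrA twistbar_comul1 comul1_twist (twist_counitl T).
by rewrite mulr1 -[in RHS]mulrA eps_twistbar mulrA.
Qed.

Lemma twist_comulA h :
  comul_id (twist_comul Delta Th Thbar) (twist_comul Delta Th Thbar h) =
  id_comul (twist_comul Delta Th Thbar) (twist_comul Delta Th Thbar h).
Proof.
rewrite comul_id_twist id_comul_twist /twist_comul.
rewrite !(comul_idM (comulM W)) !(id_comulM (comulM W)) !mulrA.
rewrite (twistbar_cocycle T) -!mulrA (twist_cocycle T) !mulrA.
by rewrite (comulA W).
Qed.

Lemma twist_comul1_12_23 :
  comul_id (twist_comul Delta Th Thbar) (twist_comul Delta Th Thbar 1) =
  leg12 (twist_comul Delta Th Thbar 1) * leg23 (twist_comul Delta Th Thbar 1).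
Proof.
rewrite comul_id_twist twist_comul1 -[Th in comul_id _ (_ * Th)]comul1_twist.
rewrite !(comul_idM (comulM W)) -!mulrA (twist_cocycle T) !mulrA (comulA W).
rewrite -(mulrA _ (id_comul _ (Delta 1))) -(id_comulM (comulM W)) comul1_twist.
by rewrite -(mulrA (leg12 _) _ (id_comul _ _)) (twist_mixed12 T) !leg12M !leg23M !mulrA.
Qed.

Lemma twist_comul1_23_12 :
  comul_id (twist_comul Delta Th Thbar) (twist_comul Delta Th Thbar 1) =
  leg23 (twist_comul Delta Th Thbar 1) * leg12 (twist_comul Delta Th Thbar 1).
Proof.
rewrite comul_id_twist twist_comul1.
rewrite -[Thbar in comul_id _ (Thbar * _)]twistbar_comul1.
rewrite !(comul_idM (comulM W)) !mulrA (twistbar_cocycle T) (comulA W).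
rewrite -(mulrA _ (id_comul _ Thbar)) -(id_comulM (comulM W)) twistbar_comul1.
by rewrite -(mulrA _ (id_comul _ Thbar)) (twist_mixed23 T) !leg12M !leg23M !mulrA.
Qed.

End TwistedBialgebra.

Section TwistedWeakBialgebra.
Context (Delta : {linear H -> H2}) (eps : {scalar H}) (Th Thbar : H2).
Context (W : weak_bialgebra Delta eps) (T : twist Delta eps Th Thbar).

Lemma weak_bialgebra_twist : weak_bialgebra (twist_comul Delta Th Thbar) eps.
Proof.
have Wop := weak_bialgebra_op W; have Top := twist_op T.
split=> [h|h|h|h g|h g f|h g f||] /=.
- exact: twist_comulA W T h.
- exact: twist_comul_counit_id W T h.
- rewrite -counit_id_flip. rewrite flip_twist_comul.
  exact: twist_comul_counit_id Wop Top h.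
- exact: twist_comulM W T h g.
- by rewrite counitM12_lift; exact: twist_eps_mul12 W T h g f.
- rewrite counitM21_lift -eps_id_counit -counit_id_flip 2!flipM.
  rewrite flip_twist_comul !flipE; exact: twist_eps_mul12 Wop Top h g f.
- exact: twist_comul1_12_23 W T.
- exact: twist_comul1_23_12 W T.
Qed.

End TwistedWeakBialgebra.
End Twist.

(** * Actions of the tensor square defined by the antipode *)

Section AntipodeActions.
Context (k : comPzRingType) (H : pzAlgType k).
Local Notation H2 := (H ⊗ H)%type.
Local Notation H3 := (H ⊗ H ⊗ H)%type.
Local Notation "1" := (GRing.one H) (only parsing) : ring_scope.
Context (Delta : {linear H -> H2}) (eps : {scalar H}) (S : {linear H -> H}).

Definition target (h : H) : H := counit_id eps (Delta 1 * (h ⊗ 1)).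
Definition source (h : H) : H := id_counit eps ((1 ⊗ h) * Delta 1).

Fact target_linear : linear target.
Proof. by move=> a x y; rewrite /target tensDl tensZl mulrDr pzscaleMr linearP. Qed.
HB.instance Definition _ := GRing.isLinear.Build k H H *:%R target target_linear.

Fact source_linear : linear source.
Proof. by move=> a x y; rewrite /source tensDr tensZr mulrDl pzscaleMl linearP. Qed.
HB.instance Definition _ := GRing.isLinear.Build k H H *:%R source source_linear.

Definition lact (z : H) (x : H2) : H := tens_lift (fun a b : H => a * z * S b) x.
Definition ract (z : H) (x : H2) : H := tens_lift (fun a b : H => S a * z * b) x.
Definition conv_S_target (x : H2) : H :=
  tens_lift (fun a b : H => S a * target b) x.
Definition conv_source_S (x : H2) : H :=
  tens_lift (fun a b : H => source a * S b) x.

Lemma lact_bilin z : bilin (fun a b : H => a * z * S b).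
Proof. bilin_tac. Qed.
HB.instance Definition _ z := GRing.isLinear.Build k H2 H *:%R (lact z)
  (tens_lift_linear (lact_bilin z)).

Lemma ract_bilin z : bilin (fun a b : H => S a * z * b).
Proof. bilin_tac. Qed.
HB.instance Definition _ z := GRing.isLinear.Build k H2 H *:%R (ract z)
  (tens_lift_linear (ract_bilin z)).

Lemma conv_S_target_bilin : bilin (fun a b : H => S a * target b).
Proof. bilin_tac. Qed.
HB.instance Definition _ := GRing.isLinear.Build k H2 H *:%R conv_S_target
  (tens_lift_linear conv_S_target_bilin).

Lemma conv_source_S_bilin : bilin (fun a b : H => source a * S b).
Proof. bilin_tac. Qed.
HB.instance Definition _ := GRing.isLinear.Build k H2 H *:%R conv_source_S
  (tens_lift_linear conv_source_S_bilin).

(** Evaluations [x¹ z₁ S(x²) z₂ x³] and [S(x¹) z₁ x² z₂ S(x³)] on the threefold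
    tensor product; the mixed twist equations are evaluated with them. *)
Definition mix3 (z1 z2 : H) (X : H3) : H :=
  tens_lift (fun (u : H2) (c : H) => lact z1 u * z2 * c) X.
Definition alt3 (z1 z2 : H) (X : H3) : H :=
  tens_lift (fun (u : H2) (c : H) => ract z1 u * z2 * S c) X.

Lemma mix3_bilin z1 z2 : bilin (fun (u : H2) (c : H) => lact z1 u * z2 * c).
Proof. bilin_tac. Qed.
HB.instance Definition _ z1 z2 := GRing.isLinear.Build k H3 H *:%R (mix3 z1 z2)
  (tens_lift_linear (mix3_bilin z1 z2)).

Lemma alt3_bilin z1 z2 : bilin (fun (u : H2) (c : H) => ract z1 u * z2 * S c).
Proof. bilin_tac. Qed.
HB.instance Definition _ z1 z2 := GRing.isLinear.Build k H3 H *:%R (alt3 z1 z2)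
  (tens_lift_linear (alt3_bilin z1 z2)).

Lemma lactE z a b : lact z (a ⊗ b) = a * z * S b.
Proof. exact: tens_liftE (lact_bilin z) a b. Qed.
Lemma ractE z a b : ract z (a ⊗ b) = S a * z * b.
Proof. exact: tens_liftE (ract_bilin z) a b. Qed.
Lemma conv_S_targetE a b : conv_S_target (a ⊗ b) = S a * target b.
Proof. exact: tens_liftE conv_S_target_bilin a b. Qed.
Lemma conv_source_SE a b : conv_source_S (a ⊗ b) = source a * S b.
Proof. exact: tens_liftE conv_source_S_bilin a b. Qed.
Lemma mix3E z1 z2 (u : H2) c : mix3 z1 z2 (u ⊗ c) = lact z1 u * z2 * c.
Proof. exact: tens_liftE (mix3_bilin z1 z2) u c. Qed.
Lemma alt3E z1 z2 (u : H2) c : alt3 z1 z2 (u ⊗ c) = ract z1 u * z2 * S c.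
Proof. exact: tens_liftE (alt3_bilin z1 z2) u c. Qed.

Lemma m_id_antipode_lact x : m_id_antipode S x = lact 1 x.
Proof. by apply: eq_tens_lift => a b; rewrite mulr1. Qed.

Lemma m_antipode_id_ract x : m_antipode_id S x = ract 1 x.
Proof. by apply: eq_tens_lift => a b; rewrite mulr1. Qed.

Lemma lact_shift z (x : H2) : lact z x = lact 1 (x * (z ⊗ 1)).
Proof. by tens_induct x as a b; pureE; rewrite !lactE !mulr1. Qed.

Lemma ract_shift z (x : H2) : ract z x = ract 1 ((1 ⊗ z) * x).
Proof. by tens_induct x as a b; pureE; rewrite !ractE !mulr1 mulrA. Qed.

Lemma alt3_id_comul z1 z2 a b :
  alt3 z1 z2 (id_comul Delta (a ⊗ b)) = S a * z1 * lact z2 (Delta b).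
Proof.
rewrite id_comul_tens; move: (Delta b) => u; tens_induct u as c d; pureE.
by rewrite alt3E ractE lactE !mulrA.
Qed.

Lemma alt3_comul_id z1 z2 a b :
  alt3 z1 z2 (comul_id Delta (a ⊗ b)) = ract z1 (Delta a) * z2 * S b.
Proof. by pureE; rewrite alt3E. Qed.

(** [S(X¹Y¹) X²Y² S(Y³) S(X³)].  On iterated coproducts of [h] and [g] it is the
    convolution product of [S ∘ m], [m] and the map [x ⊗ y ↦ S(y)S(x)], evaluated
    at [h ⊗ g]. *)
Definition anticonv (X Y : H3) : H :=
  tens_lift (fun (u : H2) (c : H) =>
    tens_lift (fun (w : H2) (d : H) => ract 1 (u * w) * S d * S c) Y) X.

Lemma anticonv_bilin_in (x : H2) e :
  bilin (fun (w : H2) (d : H) => ract 1 (x * w) * S d * S e).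
Proof. bilin_tac. Qed.

Lemma anticonv_bilin_out Y : bilin (fun (u : H2) (c : H) =>
    tens_lift (fun (w : H2) (d : H) => ract 1 (u * w) * S d * S c) Y).
Proof.
split=> [v c u u'|u c v v'] /=; rewrite scaler_sumr -big_split /=;
  apply: eq_bigr => p _.
  by rewrite ?(linearP, mulrDl, mulrDr, pzscaleMl, pzscaleMr).
by rewrite ?(linearP, mulrDl, mulrDr, pzscaleMl, pzscaleMr).
Qed.
Lemma anticonvE (u w : H2) c d :
  anticonv (u ⊗ c) (w ⊗ d) = ract 1 (u * w) * S d * S c.
Proof.
by rewrite /anticonv (tens_liftE (anticonv_bilin_out _)) (tens_liftE (anticonv_bilin_in _ _)).
Qed.

Lemma anticonvDl X X' Y : anticonv (X + X') Y = anticonv X Y + anticonv X' Y.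
Proof. exact: tens_liftD (anticonv_bilin_out Y) X X'. Qed.

Lemma anticonv0l Y : anticonv 0 Y = 0.
Proof. exact: tens_lift0 (anticonv_bilin_out Y). Qed.

Lemma anticonvDr X Y Y' : anticonv X (Y + Y') = anticonv X Y + anticonv X Y'.
Proof.
elim/tens_ind: X => [|u c X IH]; first by rewrite !anticonv0l addr0.
rewrite !anticonvDl IH addrACA; congr (_ + _).
rewrite /anticonv !(tens_liftE (anticonv_bilin_out _)).
exact: tens_liftD (anticonv_bilin_in u c) Y Y'.
Qed.

Lemma anticonv0r X : anticonv X 0 = 0.
Proof. by apply: (addrI (anticonv X 0)); rewrite -anticonvDr !addr0. Qed.

End AntipodeActions.

(* From here on the distribution tactic also knows anticonv, which is additive
   in two variables. *)
Ltac linE ::= rewrite ?(anticonvDl, anticonvDr, anticonv0l, anticonv0r, linearD, linear0,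
  mulrDl, mulrDr, mul0r, mulr0, tensDl, tensDr, tens0l, tens0r, scalerDl,
  scalerDr, scaler0, scale0r, addr0) /=.

(** * The antipode reverses products *)

Section AntipodeMultiplicativity.
Context (k : comPzRingType) (H : pzAlgType k).
Local Notation H2 := (H ⊗ H)%type.
Local Notation H3 := (H ⊗ H ⊗ H)%type.
Local Notation "1" := (GRing.one H) (only parsing) : ring_scope.
Context (Delta : {linear H -> H2}) (eps : {scalar H}) (S : {linear H -> H}).
Context (WH : weak_hopf Delta eps S).
Let W := weak_hopf_bialgebra WH.
Local Notation target := (target Delta eps).
Local Notation source := (source Delta eps).
Local Notation conv_S_target := (conv_S_target Delta eps S).
Local Notation conv_source_S := (conv_source_S Delta eps S).

Lemma target1 : target 1 = 1.
Proof. by rewrite /target tens1 mulr1 (comul_counitl W). Qed.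

Lemma source1 : source 1 = 1.
Proof. by rewrite /source tens1 mul1r (comul_counitr W). Qed.

Lemma lact1_comul h : lact S 1 (Delta h) = target h.
Proof. by rewrite -m_id_antipode_lact (antipode_target WH). Qed.

Lemma ract1_comul h : ract S 1 (Delta h) = source h.
Proof. by rewrite -m_antipode_id_ract (antipode_source WH). Qed.

(** This makes [target h] pass through coproducts, which turns [a₁ z S(a₂)] into
    the target of [a z] for [z = target h]. *)
Lemma comul_target h : Delta (target h) = Delta 1 * (target h ⊗ 1).
Proof. by have [] := comul_counit_id1 W 1 h; rewrite tens1 mul1r. Qed.

Lemma comul_source h : Delta (source h) = (1 ⊗ source h) * Delta 1.
Proof. by have [_] := comul_id_counit1 W h 1; rewrite tens1 mulr1. Qed.

Lemma eq_target a b : (forall c, eps (c * a) = eps (c * b)) -> target a = target b.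
Proof.
move=> E; rewrite /target; move: (Delta 1) => u.
by tens_induct u as c d; pureE; rewrite E.
Qed.

Lemma eq_source a b : (forall c, eps (a * c) = eps (b * c)) -> source a = source b.
Proof.
move=> E; rewrite /source; move: (Delta 1) => u.
by tens_induct u as c d; pureE; rewrite E.
Qed.

Lemma lact_target a b : lact S (target b) (Delta a) = target (a * b).
Proof.
rewrite lact_shift -(comul1r W) -mulrA -comul_target -(comulM W) lact1_comul.
by apply: eq_target => c; rewrite !mulrA; exact: eps_target W (c * a) b.
Qed.

Lemma ract_source a b : ract S (source a) (Delta b) = source (a * b).
Proof.
rewrite ract_shift -(comul1l W) mulrA -comul_source -(comulM W) ract1_comul.
by apply: eq_source => c; rewrite -!mulrA; exact: eps_source W a (b * c).
Qed.

(** The iterated coproduct of 1 is [1₁ ⊗ 1₂1'₁ ⊗ 1'₂] and also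
    [1₁ ⊗ 1'₁1₂ ⊗ 1'₂]; contracting its outer factors with the counit gives the
    two orders. *)
Lemma source_target_comm a b : source a * target b = target b * source a.
Proof.
pose f X := counit_id eps (counit3 eps
  ((1 ⊗ 1 ⊗ a) * X * (b ⊗ 1 ⊗ 1))).
have f12 (x y : H2) : f (leg12 x * leg23 y) =
    counit_id eps (x * (b ⊗ 1)) * id_counit eps ((1 ⊗ a) * y).
  rewrite /f; tens_induct x as p q; tens_induct y as r s; pureE.
  by rewrite counit3E; pureE; rewrite linearZ /= pzscaleMl pzscaleMr counit_idE
    !scalerA mulrC.
have f21 (x y : H2) : f (leg23 y * leg12 x) =
    id_counit eps ((1 ⊗ a) * y) * counit_id eps (x * (b ⊗ 1)).
  rewrite /f; tens_induct x as p q; tens_induct y as r s; pureE.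
  by rewrite counit3E; pureE; rewrite linearZ /= pzscaleMl pzscaleMr counit_idE
    !scalerA.
by rewrite /source /target -f12 -f21 -(id_comul1_12_23 W) (id_comul1_23_12 W).
Qed.

Lemma alt3_comul h : alt3 S 1 1 (comul_id Delta (Delta h)) = S h.
Proof.
rewrite -(antipode_mul3 WH); apply: eq_tens_lift => u c.
by rewrite m_antipode_id_ract mulr1.
Qed.

Lemma conv_S_target_comul h : conv_S_target (Delta h) = S h.
Proof.
rewrite -alt3_comul (comulA W); move: (Delta h) => x.
tens_induct x as a b.
by rewrite conv_S_targetE alt3_id_comul lact1_comul mulr1.
Qed.

Lemma conv_source_S_comul h : conv_source_S (Delta h) = S h.
Proof.
rewrite -alt3_comul; move: (Delta h) => x.
tens_induct x as a b.
by rewrite conv_source_SE alt3_comul_id ract1_comul mulr1.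
Qed.

Lemma anticonv_id_comul x y :
  anticonv S (id_comul Delta x) (id_comul Delta y) = conv_S_target (x * y).
Proof.
tens_induct x as a b; tens_induct y as c d; pureE.
rewrite conv_S_targetE -lact_target -lact1_comul !id_comul_tens.
move: (Delta b) (Delta d) => u w.
tens_induct u as e f; rewrite lactE; tens_induct w as g h; pureE.
by rewrite anticonvE; pureE; rewrite !(lactE, ractE) !mulr1 !mulrA.
Qed.

(** The inserted source element commutes past the target element that the
    remaining factors produce. *)
Lemma alt3_source_comul2 a h :
  alt3 S (source a) 1 (comul_id Delta (Delta h)) = S h * source a.
Proof.
rewrite (comulA W) -(conv_S_target_comul h); move: (Delta h) => x.
tens_induct x as c d.
rewrite alt3_id_comul lact1_comul conv_S_targetE -!mulrA.
by rewrite source_target_comm.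
Qed.

Lemma anticonv_comul_id x h :
  anticonv S (comul_id Delta x) (comul_id Delta (Delta h)) =
  S h * conv_source_S x.
Proof.
tens_induct x as a b.
rewrite conv_source_SE mulrA -alt3_source_comul2.
move: (Delta h) => y; tens_induct y as c d.
rewrite alt3_comul_id ract_source mulr1; pureE.
by rewrite anticonvE -(comulM W) ract1_comul.
Qed.

(** Uniqueness of convolution inverses: coassociativity lets [anticonv] be
    evaluated by first contracting its last factors, which leaves [S(hg)], or its
    first factors, which leaves [S(g) S(h)]. *)
Lemma antipodeM h g : S (h * g) = S g * S h.
Proof.
rewrite -conv_S_target_comul (comulM W) -anticonv_id_comul -!(comulA W).
by rewrite anticonv_comul_id conv_source_S_comul.
Qed.

Lemma lact_act z (x y : H2) : lact S z (x * y) = lact S (lact S z y) x.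
Proof.
tens_induct x as a b; rewrite lactE.
by tens_induct y as c d; pureE; rewrite !lactE antipodeM !mulrA.
Qed.

Lemma ract_act z (x y : H2) : ract S z (x * y) = ract S (ract S z x) y.
Proof.
tens_induct y as c d; rewrite ractE.
by tens_induct x as a b; pureE; rewrite !ractE antipodeM !mulrA.
Qed.

(** For [s = 1₁ ε(1₂ b)] one has [Δ(s) = (1 ⊗ s)Δ(1)], so the target of [s] is
    [1₁ S(s 1₂) = S(s)]; and [s] has the same target as [b]. *)
Lemma antipode_source_op b : S (id_counit eps (Delta 1 * (1 ⊗ b))) = target b.
Proof.
set s := id_counit _ _.
have -> : target b = target s.
  by apply: eq_target => c; rewrite (eps_source_op W).
have [_] := comul_id_counit1 W 1 b; rewrite tens1 mul1r -/s => Ds.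
rewrite -lact1_comul Ds.
have -> (x : H2) : lact S 1 ((1 ⊗ s) * x) = lact S 1 x * S s.
  by tens_induct x as c d; pureE; rewrite !lactE antipodeM !mulrA.
by rewrite lact1_comul target1 mul1r.
Qed.

Lemma antipode1 : S 1 = 1.
Proof.
by rewrite -{2}target1 -antipode_source_op tens1 mulr1 (comul_counitr W).
Qed.

Lemma antipode_target_op a : S (counit_id eps ((a ⊗ 1) * Delta 1)) = source a.
Proof.
set t := counit_id _ _.
have -> : source a = source t.
  by apply: eq_source => c; rewrite (eps_target_op W).
have [] := comul_counit_id1 W a 1; rewrite tens1 mulr1 -/t => Dt _.
rewrite -ract1_comul Dt.
have -> (x : H2) : ract S 1 (x * (t ⊗ 1)) = S t * ract S 1 x.
  by tens_induct x as c d; pureE; rewrite !ractE antipodeM !mulrA.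
by rewrite ract1_comul source1 mulr1.
Qed.

Lemma conv_S_target_id_counit x :
  conv_S_target x = S (id_counit eps (Delta 1 * x)).
Proof.
tens_induct x as a b; rewrite conv_S_targetE -antipode_source_op -antipodeM.
by rewrite -id_counit_mul1r -mulrA tensM mul1r mulr1.
Qed.

Lemma conv_source_S_counit_id x :
  conv_source_S x = S (counit_id eps (x * Delta 1)).
Proof.
tens_induct x as a b; rewrite conv_source_SE -antipode_target_op -antipodeM.
by rewrite -counit_id_mull.
Qed.

(** In [x¹ y¹₁ z₁ S(x²₁ y¹₂) z₂ x²₂ y²] the antipode splits, giving
    [x¹ target(y¹ h) source(g x²) y²]; the two counital elements commute, and the
    expression falls apart into a factor for [x] and a factor for [y]. *)
Lemma mix3_comul g h (x y : H2) :
  mix3 S (target h) (source g) (id_comul Delta x * comul_id Delta y) =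
  id_counit eps ((1 ⊗ g) * x * Delta 1) * counit_id eps (Delta 1 * y * (h ⊗ 1)).
Proof.
tens_induct x as a b; tens_induct y as c d.
transitivity (a * (lact S (target h) (Delta c) * ract S (source g) (Delta b)) * d).
  rewrite id_comul_tens comul_idE; move: (Delta b) (Delta c) => u w.
  tens_induct u as p q; tens_induct w as r s; pureE.
  by rewrite mix3E !lactE ractE antipodeM !mulrA.
rewrite lact_target ract_source -source_target_comm.
have -> : (1 ⊗ g) * (a ⊗ b) = (a ⊗ 1) * (1 ⊗ (g * b)) by pureE.
rewrite -[(a ⊗ 1) * _ * _]mulrA id_counit_mul1l.
have -> : Delta 1 * (c ⊗ d) * (h ⊗ 1) = Delta 1 * ((c * h) ⊗ 1) * (1 ⊗ d).
  by rewrite -!mulrA; pureE.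
by rewrite counit_id_mul1r !mulrA.
Qed.

(** The same factorization as in [mix3_comul], for
    [S(x¹₁ y¹) x¹₂ y²₁ S(x² y²₂)]. *)
Lemma alt3_comul_mul (x y : H2) :
  alt3 S 1 1 (comul_id Delta x * id_comul Delta y) =
  conv_S_target y * conv_source_S x.
Proof.
tens_induct x as a b; tens_induct y as c d.
rewrite conv_S_targetE conv_source_SE mulrA -[_ * source a]mulrA.
rewrite -source_target_comm -ract1_comul -lact1_comul id_comul_tens comul_idE.
move: (Delta a) (Delta d) => u w.
tens_induct u as p q; tens_induct w as r s; pureE.
by rewrite alt3E !ractE !lactE !antipodeM !mulr1 !mulrA.
Qed.

Lemma mix3_legs z1 z2 (x y : H2) :
  mix3 S z1 z2 (leg23 x * leg12 y) = lact S z1 y * ract S z2 x.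
Proof.
tens_induct x as a b; tens_induct y as c d; pureE.
by rewrite mix3E !lactE ractE antipodeM !mulrA.
Qed.

Lemma alt3_legs z1 z2 (x y : H2) (X : H3) :
  alt3 S z1 z2 (leg12 x * X * leg23 y) =
  alt3 S (ract S z1 x) (lact S z2 y) X.
Proof.
tens_induct X as u c; tens_induct u as a b; rewrite alt3E ractE.
tens_induct x as d e; rewrite ractE; tens_induct y as f g; rewrite lactE; pureE.
by rewrite alt3E ractE !antipodeM !mulrA.
Qed.

End AntipodeMultiplicativity.

(** * The twisted antipode *)

Section TwistedAntipode.
Context (k : comPzRingType) (H : pzAlgType k).
Local Notation H2 := (H ⊗ H)%type.
Local Notation H3 := (H ⊗ H ⊗ H)%type.
Local Notation "1" := (GRing.one H) (only parsing) : ring_scope.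
Context (Delta : {linear H -> H2}) (eps : {scalar H}) (S : {linear H -> H}).
Context (Th Thbar : H2).
Context (WH : weak_hopf Delta eps S) (T : twist Delta eps Th Thbar).
Let W := weak_hopf_bialgebra WH.

Definition twist_elt_inv : H := lact S 1 Thbar.
Local Notation v := (twist_elt S Th).
Local Notation w := twist_elt_inv.

Lemma twist_elt_ract : v = ract S 1 Th.
Proof. exact: m_antipode_id_ract. Qed.

(** The left side is [mix3] of [leg23 Θ * leg12 Θ̄], and a mixed equation brings
    this product into the form that [mix3_comul] factorizes. *)
Lemma lact_twistbar_ract_twist g h :
  lact S (target Delta eps h) Thbar * ract S (source Delta eps g) Th =
  id_counit eps ((1 ⊗ g) * Thbar) * counit_id eps (Th * (h ⊗ 1)).
Proof.
rewrite -(mix3_legs WH) -(twist_mixed23 T) (mix3_comul WH).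
by rewrite -mulrA (twistbar_comul1 W T) (comul1_twist W T).
Qed.

Lemma lact_twistbar_target h :
  lact S (target Delta eps h) Thbar * v = counit_id eps (Th * (h ⊗ 1)).
Proof.
have := lact_twistbar_ract_twist 1 h.
by rewrite (source1 WH) tens1 mul1r (twistbar_counitr T) mul1r -twist_elt_ract.
Qed.

Lemma ract_twist_source g :
  w * ract S (source Delta eps g) Th = id_counit eps ((1 ⊗ g) * Thbar).
Proof.
have := lact_twistbar_ract_twist g 1.
by rewrite (target1 WH) tens1 mulr1 (twist_counitl T) mulr1.
Qed.

Lemma twist_elt_invK : w * v = 1.
Proof.
have := lact_twistbar_target 1.
by rewrite (target1 WH) tens1 mulr1 (twist_counitl T).
Qed.

Lemma conv_source_S_twistbar : conv_source_S Delta eps S Thbar = 1.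
Proof.
rewrite (conv_source_S_counit_id WH) (twistbar_comul1 W T).
by rewrite (twistbar_counitl T) (antipode1 WH).
Qed.

Lemma twist_eltK : v * w = 1.
Proof.
have := alt3_legs WH 1 1 Th Thbar (1 ⊗ 1 ⊗ 1).
rewrite !tens1 mulr1 -(twist_mixed12 T) (alt3_comul_mul WH).
rewrite conv_source_S_twistbar (conv_S_target_id_counit WH).
rewrite (comul1_twist W T) (twist_counitr T) mulr1 -!tens1 alt3E ractE.
by rewrite (antipode1 WH) mul1r !mulr1 -twist_elt_ract => <-.
Qed.

Lemma lact_twist : lact S w Th = 1.
Proof.
by rewrite -(lact_act WH) (twistK T) (lact1_comul WH) (target1 WH).
Qed.

Lemma ract_twistbar : ract S v Thbar = 1.
Proof.
rewrite twist_elt_ract -(ract_act WH) (twistK T) (ract1_comul WH).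
exact: source1 WH.
Qed.

Lemma weak_hopf_twist :
  weak_hopf (twist_comul Delta Th Thbar) eps (twist_antipode S v w).
Proof.
have m_id x : m_id_antipode (twist_antipode S v w) x = lact S w x * v.
  tens_induct x as a b; rewrite m_id_antipodeE lactE /= /twist_antipode.
  by rewrite !mulrA.
have m_idl x : m_antipode_id (twist_antipode S v w) x = w * ract S v x.
  tens_induct x as a b; rewrite m_antipode_idE ractE /= /twist_antipode.
  by rewrite !mulrA.
split=> [|h|h|h] /=.
- exact: weak_bialgebra_twist W T.
- rewrite m_id /twist_comul -mulrA !(lact_act WH) lact_twist (lact1_comul WH).
  rewrite lact_twistbar_target -mulrA (counit_id_comul W).
  rewrite (twistbar_comul1 W T) (twistbar_counitl T) !mul1r.
  by rewrite mulrA (comul1_twist W T).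
- rewrite m_idl /twist_comul !(ract_act WH) ract_twistbar (ract1_comul WH).
  rewrite ract_twist_source !mulrA (id_counit_comul W).
  rewrite (comul1_twist W T) (twist_counitr T) !mulr1.
  by rewrite -mulrA (twistbar_comul1 W T).
- have alt3_twist X : tens_lift (fun (h12 : H2) (h3 : H) =>
      m_antipode_id (twist_antipode S v w) h12 * twist_antipode S v w h3) X
      = w * alt3 S v w X * v.
    have bX := antipode_mul3_bilin (twist_antipode S v w).
    elim/tens_ind: X => [|u c X IH].
      by rewrite (tens_lift0 bX); linE.
    rewrite (tens_liftD bX) (tens_liftE bX) IH; linE; congr (_ + _).
    by rewrite alt3E m_idl /twist_antipode !mulrA.
  (* The outer twists are absorbed into v and w by lact_twist and ract_twistbar;
     what remains has the shape of alt3_comul_mul. *)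
  rewrite alt3_twist comul_id_twist /twist_comul !(comul_idM (comulM W)).
  rewrite -!mulrA (twist_cocycle T) (mulrA _ _ (leg23 _)).
  rewrite (comulA W) -(id_comulM (comulM W)) (mulrA _ _ (leg23 _)).
  rewrite (mulrA (leg12 _)) (alt3_legs WH) ract_twistbar lact_twist.
  rewrite (alt3_comul_mul WH) conv_source_S_twistbar mulr1.
  rewrite (conv_S_target_id_counit WH) [Delta 1 * _]mulrA (id_counit_comul W).
  rewrite (comul1l W) (comul_counitr W) mul1r (comul1_twist W T).
  by rewrite (twist_counitr T) mulr1 /twist_antipode mulrA.
Qed.

End TwistedAntipode.

(** * The twisted R-matrix *)

Section TwistedRMatrix.
Context (k : comPzRingType) (H : pzAlgType k).
Local Notation H2 := (H ⊗ H)%type.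
Local Notation H3 := (H ⊗ H ⊗ H)%type.
Local Notation "1" := (GRing.one H) (only parsing) : ring_scope.

Lemma cyc3_comul_id (Delta : {linear H -> H2}) (x : H2) :
  cyc3 (comul_id Delta x) = id_comul Delta (flip x).
Proof.
tens_induct x as a b; rewrite flipE id_comul_tens; pureE.
by move: (Delta a) => u; tens_induct u as c d; pureE.
Qed.

Lemma leg12_comul_id (Delta : {linear H -> H2}) (R x : H2) :
  (forall h, op_comul Delta h * R = R * Delta h) ->
  leg12 R * comul_id Delta x = swap12 (comul_id Delta x) * leg12 R.
Proof.
move=> RD; tens_induct x as a b; rewrite leg12_tens; pureE.
by rewrite -RD op_comulE.
Qed.

Lemma cyc3_id_comul_leg13 (Delta : {linear H -> H2}) (R x : H2) :
  (forall h, op_comul Delta h * R = R * Delta h) ->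
  cyc3 (id_comul Delta x) * leg13 R = leg13 R * swap12 (id_comul Delta x).
Proof.
move=> RD; tens_induct x as a b; rewrite id_comul_tens.
have cycE (u : H2) : cyc3 ((a ⊗ 1 ⊗ 1) * leg23 u) =
    (1 ⊗ a ⊗ 1) * leg13 (flip u).
  by tens_induct u as c d; pureE.
have swapE (u : H2) : swap12 ((a ⊗ 1 ⊗ 1) * leg23 u) = leg13 u * (1 ⊗ a ⊗ 1).
  by tens_induct u as c d; pureE.
have comm (u : H2) : (1 ⊗ a ⊗ 1) * leg13 u = leg13 u * (1 ⊗ a ⊗ 1).
  by tens_induct u as c d; pureE.
by rewrite cycE swapE -mulrA -leg13M -op_comulE RD comm leg13M mulrA.
Qed.

(** Starting from
    [Θ̄₂₃ (id ⊗ Δ)(Θ̄₂₁) R₁₃ R₁₂ (id ⊗ Δ)(Θ) Θ₂₃], the cocycle equations replace the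
    outer pairs by [Θ̄₃₁] times a coproduct on factors 3 and 1, and by a coproduct
    on factors 1 and 2 times [Θ₁₂].  Both coproducts move inwards past [R₁₃] and
    [R₁₂] and meet in a permuted mixed equation, which is [Θ₁₃ Θ̄₂₁]. *)
Lemma id_comul_twistR (Delta : {linear H -> H2}) (eps : {scalar H})
    (R Th Thbar : H2) :
  weak_bialgebra Delta eps -> twist Delta eps Th Thbar ->
  (forall h, op_comul Delta h * R = R * Delta h) ->
  id_comul Delta R = leg13 R * leg12 R ->
  id_comul (twist_comul Delta Th Thbar) (flip Thbar * R * Th) =
  leg13 (flip Thbar * R * Th) * leg12 (flip Thbar * R * Th).
Proof.
move=> W T RD RR.
rewrite id_comul_twist !(id_comulM (comulM W)) RR.
rewrite -!mulrA -(twist_cocycle T) (mulrA (leg12 R)) (leg12_comul_id _ RD).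
rewrite (mulrA (leg23 Thbar)) -{1}cyc3_leg12 -cyc3_comul_id -cyc3M.
rewrite (twistbar_cocycle T) cyc3M cyc3_leg23 -!mulrA (mulrA _ (leg13 R)).
rewrite (cyc3_id_comul_leg13 _ RD) -!mulrA (mulrA (swap12 _) (swap12 _)).
rewrite -swap12M (twist_mixed23 T) swap12M swap12_leg23 swap12_leg12.
by rewrite !leg12M !leg13M !mulrA.
Qed.

(** The other hexagon for [R] is the first hexagon for [R₂₁] over the reversed
    coproduct. *)
Lemma comul_id_twistR (Delta : {linear H -> H2}) (eps : {scalar H})
    (R Th Thbar : H2) :
  weak_bialgebra Delta eps -> twist Delta eps Th Thbar ->
  (forall h, op_comul Delta h * R = R * Delta h) ->
  comul_id Delta R = leg13 R * leg23 R ->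
  comul_id (twist_comul Delta Th Thbar) (flip Thbar * R * Th) =
  leg13 (flip Thbar * R * Th) * leg23 (flip Thbar * R * Th).
Proof.
move=> W T RD RR.
have Rop : id_comul (op_comul Delta) (flip R) = leg13 (flip R) * leg12 (flip R).
  by rewrite -rev3_comul_id RR rev3M rev3_leg13 rev3_leg23.
have RDop h : op_comul (op_comul Delta) h * flip R = flip R * op_comul Delta h.
  by rewrite [in RHS]op_comulE -flipM -RD flipM.
have := id_comul_twistR (weak_bialgebra_op W) (twist_op T) RDop Rop.
have -> : flip (flip Thbar) * flip R * flip Th = flip (flip Thbar * R * Th).
  by rewrite !flipM.
rewrite id_comul_twist -rev3_comul_id -!rev3_leg12 -!rev3M -comul_id_twist.
move=> E; apply: (can_inj (@rev3K _ _)).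
by rewrite E rev3M rev3_leg13 rev3_leg23.
Qed.

End TwistedRMatrix.

Theorem mainTheorem2 (k : closedFieldType) (H : pzAlgType k)
    (Delta : {linear H -> (H ⊗ H)%type}) (eps : {scalar H})
    (S : {linear H -> H}) (R Rbar Th Thbar : (H ⊗ H)%type) :
  quasitriangular Delta eps S R Rbar ->
  twist Delta eps Th Thbar ->
  exists vinv : H,
    [/\ twist_elt S Th * vinv = 1, vinv * twist_elt S Th = 1 &
        quasitriangular (twist_comul Delta Th Thbar) eps
          (twist_antipode S (twist_elt S Th) vinv)
          (flip Thbar * R * Th) (Thbar * Rbar * flip Th)].
Proof.
move=> Q T; have WH := quasitriangular_weak_hopf Q.
have W := weak_hopf_bialgebra WH.
exists (twist_elt_inv S Thbar); split.
- exact: twist_eltK WH T.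
- exact: twist_elt_invK WH T.
have Del1 : twist_comul Delta Th Thbar 1 = Thbar * Th := twist_comul1 W T.
have opDel h : op_comul (twist_comul Delta Th Thbar) h =
    flip Thbar * (op_comul Delta h * flip Th).
  by rewrite op_comulE /= /twist_comul !flipM mulrA.
have opDel1 : op_comul (twist_comul Delta Th Thbar) 1 = flip Thbar * flip Th.
  by rewrite op_comulE /= Del1 flipM.
(* Products of neighbouring twists collapse to Delta 1 or its flip, which R and
   Rbar absorb. *)
have flipK_R y : flip Th * (flip Thbar * (R * y)) = R * y.
  case: (Rmat_dom Q) => x ->; rewrite !mulrA -flipM (twistK T).
  by rewrite !op_comulE -flipM (comul1l W).
have R_K y : R * (Th * (Thbar * y)) = R * y.
  case: (Rmat_dom Q) => x ->; rewrite !mulrA -(mulrA _ Th) (twistK T).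
  by rewrite -(mulrA _ (Delta 1) (Delta 1)) (comul1l W).
have K_Rbar y : Th * (Thbar * (Rbar * y)) = Rbar * y.
  case: (Rbar_dom Q) => x ->; rewrite !mulrA (twistK T).
  by rewrite (comul1l W).
have Rbar_flipK y : Rbar * (flip Th * (flip Thbar * y)) = Rbar * y.
  case: (Rbar_dom Q) => x ->; rewrite !mulrA -(mulrA _ (flip Th)) -flipM.
  rewrite (twistK T) !op_comulE -(mulrA _ (flip (Delta 1)) (flip (Delta 1))).
  by rewrite -flipM (comul1l W).
split=> [||||||| ] /=.
- exact: weak_hopf_twist WH T.
- exists (flip Thbar * R * Th).
  by rewrite opDel1 Del1 -!mulrA R_K flipK_R.
- exists (Thbar * Rbar * flip Th).
  by rewrite opDel1 Del1 -!mulrA K_Rbar Rbar_flipK.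
- rewrite opDel -!mulrA R_K; congr (_ * _).
  by rewrite mulrA (Rmat_Rbar Q).
- rewrite /twist_comul -!mulrA Rbar_flipK; congr (_ * _).
  by rewrite mulrA (Rbar_Rmat Q).
- move=> h; rewrite opDel /twist_comul -!mulrA R_K flipK_R; congr (_ * _).
  by rewrite !mulrA (Rmat_comul Q).
- exact: id_comul_twistR W T (Rmat_comul Q) (id_comul_Rmat Q).
- exact: comul_id_twistR W T (Rmat_comul Q) (comul_id_Rmat Q).
Qed.
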